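(* In the case $m=4$ (with $K(4)=-\frac32$), the honest (super)characters of $H(\Lambda^{[K(4),m_2]})$, $m_2=1,3$, are given by (identities of meromorphic functions of $(\tau,z)\in\mathbb{C}_+\times\mathbb{C}$): 1) (i) ${\rm ch}^{(+)}_{H(\Lambda^{[K(4),1]})}(\tau,z)=\frac i2\cdot\frac{1}{\eta(\frac\tau2)\eta(2\tau)}\cdot\frac{\vartheta_{10}(\tau,z)}{\vartheta_{01}(\tau,z)}\Big\{\frac{\eta(2\tau)^5}{\eta(\tau)^2\eta(4\tau)^2}\vartheta_{00}(2\tau,2z)-2\frac{\eta(4\tau)^2}{\eta(2\tau)}\vartheta_{10}(2\tau,2z)+\vartheta_{01}(2\tau,2z)\Big\}$; (ii) ${\rm ch}^{(+)}_{H(\Lambda^{[K(4),3]})}(\tau,z)=\frac i2\cdot\frac{1}{\eta(\frac\tau2)\eta(2\tau)}\cdot\frac{\vartheta_{10}(\tau,z)}{\vartheta_{01}(\tau,z)}\Big\{\frac{\eta(2\tau)^5}{\eta(\tau)^2\eta(4\tau)^2}\vartheta_{00}(2\tau,2z)-2\frac{\eta(4\tau)^2}{\eta(2\tau)}\vartheta_{10}(2\tau,2z)-\vartheta_{01}(2\tau,2z)\Big\}$; 2) (i) ${\rm ch}^{(-)}_{H(\Lambda^{[K(4),1]})}(\tau,z)=-\frac i2\cdot\frac{\eta(\frac\tau2)}{\eta(\tau)^3}\cdot\frac{\vartheta_{10}(\tau,z)}{\vartheta_{00}(\tau,z)}\Big\{\frac{\eta(2\tau)^5}{\eta(\tau)^2\eta(4\tau)^2}\vartheta_{00}(2\tau,2z)+2\frac{\eta(4\tau)^2}{\eta(2\tau)}\vartheta_{10}(2\tau,2z)+\vartheta_{01}(2\tau,2z)\Big\}$;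 (ii) ${\rm ch}^{(-)}_{H(\Lambda^{[K(4),3]})}(\tau,z)=-\frac i2\cdot\frac{\eta(\frac\tau2)}{\eta(\tau)^3}\cdot\frac{\vartheta_{10}(\tau,z)}{\vartheta_{00}(\tau,z)}\Big\{\frac{\eta(2\tau)^5}{\eta(\tau)^2\eta(4\tau)^2}\vartheta_{00}(2\tau,2z)+2\frac{\eta(4\tau)^2}{\eta(2\tau)}\vartheta_{10}(2\tau,2z)-\vartheta_{01}(2\tau,2z)\Big\}$.
   Context: Notation: $\mathbb{C}_+$ is the upper half-plane, $q^a:=e^{2\pi i a\tau}$, $\eta(\tau)=q^{1/24}\prod_{n\ge1}(1-q^n)$, and for $a,b\in\{0,1\}$ the Mumford theta functions are $\vartheta_{ab}(\tau,z)=\sum_{n\in\mathbb{Z}}e^{\pi i\tau(n+\frac a2)^2+2\pi i(n+\frac a2)(z+\frac b2)}$. For $m\in\frac12\mathbb{N}$, $s\in\frac12\mathbb{Z}$ put $\Phi_1^{[m,s]}(\tau,z_1,z_2,t)=e^{-2\pi imt}\sum_{j\in\mathbb{Z}}\frac{e^{2\pi imj(z_1+z_2)+2\pi isz_1}e^{2\pi i\tau(mj^2+sj)}}{1-e^{2\pi iz_1}e^{2\pi ij\tau}}$, $\Phi_2^{[m,s]}(\tau,z_1,z_2,t)=e^{-2\pi imt}\sum_{j\in\mathbb{Z}}\frac{e^{-2\pi imj(z_1+z_2)-2\pi isz_2}e^{2\pi i\tau(mj^2+sj)}}{1-e^{-2\pi iz_2}e^{2\pi ij\tau}}$, $\Phi^{[m,s]}=\Phi_1^{[m,s]}-\Phi_2^{[m,s]}$.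 N=3 denominators: $R^{(+)}(\tau,z)=\eta(\frac\tau2)\eta(2\tau)\frac{\vartheta_{11}(\tau,z)}{\vartheta_{00}(\tau,z)}$, $R^{(-)}(\tau,z)=\frac{\eta(\tau)^3}{\eta(\frac\tau2)}\frac{\vartheta_{11}(\tau,z)}{\vartheta_{01}(\tau,z)}$. For a positive integer $m$ and an integer $0\le m_2\le m$, put $K(m)=-\frac{m+2}{4}$, and let $H(\Lambda^{[K(m),m_2]})$ be the N=3 superconformal module obtained by quantum Hamiltonian reduction of the $\widehat{osp}(3|2)$-module of highest weight $K(m)\Lambda_0-\frac{m_2}2\alpha_1$. Its honest character and supercharacter are the functions given by $R^{(+)}{\rm ch}^{(+)}_{H(\Lambda^{[K(m),m_2]})}=\Phi^{[\frac m2,\frac{m_2+1}2]}(2\tau,z+\frac\tau2-\frac12,z-\frac\tau2+\frac12,\frac\tau8)$ and $R^{(-)}{\rm ch}^{(-)}_{H(\Lambda^{[K(m),m_2]})}=\Phi^{[\frac m2,\frac{m_2+1}2]}(2\tau,z+\frac\tau2,z-\frac\tau2,\frac\tau8)$. *)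

(* Defs.v *)
From Stdlib Require Import Reals ZArith.
From Coquelicot Require Import Coquelicot.

Local Open Scope C_scope.

Definition Cexp (z : C) : C :=
  (exp (Re z) * cos (Im z), exp (Re z) * sin (Im z))%R.

(** Limits and series of complex numbers are taken componentwise, with
    Coquelicot's total real operators. *)

Definition CLim_seq (u : nat -> C) : C :=
  (real (Lim_seq (fun n => Re (u n))), real (Lim_seq (fun n => Im (u n)))).

Definition CSeries (a : nat -> C) : C :=
  (Series (fun n => Re (a n)), Series (fun n => Im (a n))).

(** Bilateral sum: the two halves [n >= 0] and [n <= -1] are summed separately. *)
Definition CSeriesZ (f : Z -> C) : C :=
  CSeries (fun n => f (Z.of_nat n)) + CSeries (fun n => f (- Z.of_nat (S n))%Z).

Fixpoint Cprod (a : nat -> C) (N : nat) : C :=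
  match N with
  | O => 1
  | S k => Cprod a k * a k
  end.

(** [qpow a tau] is q^a; the exponent a belongs to q, so that fractional powers
    involve no choice of a branch. *)
Definition qpow (a : R) (tau : C) : C := Cexp (2 * PI * Ci * a * tau).

Definition eta (tau : C) : C :=
  qpow (1 / 24) tau * CLim_seq (Cprod (fun n => 1 - qpow (INR (S n)) tau)).

(** Mumford's theta functions; the characteristics a, b are meant in {0, 1}. *)
Definition theta (a b : nat) (tau z : C) : C :=
  CSeriesZ (fun n =>
    Cexp (PI * Ci * tau * (IZR n + INR a / 2) ^ 2
          + 2 * PI * Ci * (IZR n + INR a / 2) * (z + INR b / 2))).

(** The indices are meant with m in (1/2)N and s in (1/2)Z. *)
Definition Phi1 (m s : R) (tau z1 z2 t : C) : C :=
  Cexp (- (2 * PI * Ci * m * t)) *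
  CSeriesZ (fun j =>
    Cexp (2 * PI * Ci * m * IZR j * (z1 + z2) + 2 * PI * Ci * s * z1)
    * Cexp (2 * PI * Ci * tau * (m * IZR j ^ 2 + s * IZR j))
    / (1 - Cexp (2 * PI * Ci * z1) * Cexp (2 * PI * Ci * IZR j * tau))).

Definition Phi2 (m s : R) (tau z1 z2 t : C) : C :=
  Cexp (- (2 * PI * Ci * m * t)) *
  CSeriesZ (fun j =>
    Cexp (- (2 * PI * Ci * m * IZR j * (z1 + z2)) - 2 * PI * Ci * s * z2)
    * Cexp (2 * PI * Ci * tau * (m * IZR j ^ 2 + s * IZR j))
    / (1 - Cexp (- (2 * PI * Ci * z2)) * Cexp (2 * PI * Ci * IZR j * tau))).

Definition Phi (m s : R) (tau z1 z2 t : C) : C :=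
  Phi1 m s tau z1 z2 t - Phi2 m s tau z1 z2 t.

Definition R_plus (tau z : C) : C :=
  eta (tau / 2) * eta (2 * tau) * (theta 1 1 tau z / theta 0 0 tau z).

Definition R_minus (tau z : C) : C :=
  eta tau ^ 3 / eta (tau / 2) * (theta 1 1 tau z / theta 0 1 tau z).

(** Honest character and supercharacter of the N=3 module H(Lambda) obtained by
    quantum Hamiltonian reduction of the osp(3|2)^ -module of highest weight
    K(m) Lambda_0 - (m2/2) alpha_1, with K(m) = -(m+2)/4, m >= 1 and
    0 <= m2 <= m.  They are the meromorphic solutions of
    R^(+-) ch^(+-) = Phi; the module is labelled by the pair (m, m2). *)
Definition ch_plus (m m2 : nat) (tau z : C) : C :=
  Phi (INR m / 2) ((INR m2 + 1) / 2)
      (2 * tau) (z + tau / 2 - 1 / 2) (z - tau / 2 + 1 / 2) (tau / 8)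
  / R_plus tau z.

Definition ch_minus (m m2 : nat) (tau z : C) : C :=
  Phi (INR m / 2) ((INR m2 + 1) / 2)
      (2 * tau) (z + tau / 2) (z - tau / 2) (tau / 8)
  / R_minus tau z.

(* Main.v *)
(** With q = e^{2 pi i tau}, x = e^{2 pi i z} and y_k = x q^{k+1/2}, the functions Phi of the
    supercharacters are half of S + D and S - D, where
      S = sum_k x^{2k+1} q^{(k+1/2)^2} (1 + y_k) / (1 - y_k),
      D = sum_k (-1)^k x^{2k+1} q^{(k+1/2)^2} = - i theta11(2 tau, 2 z);
    those of the characters are their translates by z -> z - 1/2.
    The point is the identity S theta01 = - i theta11 theta10 theta00.  Since theta01 vanishes
    at y_k = 1, the quotient theta01 / (1 - y_k) is a Laurent series in y_k, so S theta01 is an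
    absolutely convergent triple series, and so a Laurent series in x.  Its coefficients, like
    those of theta11(2 tau, 2 z) theta00(tau, z), are determined up to a scalar by
    quasi-periodicity and by the symmetry x -> 1/x.  The scalar is found at z = - tau / 2,
    where a single term of S theta01 survives, and involves Jacobi's
    sum_n n (-1)^n q^{n(n-1)/2} = - prod (1 - q^n)^3.
    The eta quotients are theta00(2 tau, 0) and theta10(2 tau, 0) by the triple product, so the
    braces of the theorem become squares of theta functions by doubling formulas. *)

Require Import Defs.
From Stdlib Require Import Reals ZArith List Lra Lia Permutation Classical ClassicalEpsilon.
From Coquelicot Require Import Coquelicot.
Local Open Scope C_scope.
Import ListNotations.

(** * Unconditional sums *)

(** Zeros and poles are never compared: only coefficients of Laurent series are matched. This
    regroups a triple series along oblique lattice directions, so sums are limits over finite sets,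
    free of any ordering. The obstacle is convergence. A geometric expansion of 1 / (1 - y), y =
    y_k, would depend on |y|. But sum_l (-1)^l q^{l(l-1)/2} = 0, so y^l / (y - 1) may be replaced by
    the Laurent polynomial (y^l - 1) / (y - 1), which makes sense for every y, 1 included. The
    exponents n of y then satisfy |n| <= |l| + 1, and only under this restriction does the
    indefinite form 3 k^2 + 2 k n + l^2 control all three indices. Subtracting a further multiple (1
    + y) / 2 of the same zero sum makes the coefficients antisymmetric. The quasi-periodicity in x
    has degree three: its solutions have one free coefficient for each residue modulo 3, and the odd
    ones form a line, hence the single unknown scalar. At z = - tau / 2, where theta01 vanishes, the
    surviving term is the one at which S has a pole. *)

Fixpoint Csum {I : Type} (f : I -> C) (L : list I) : C :=
  match L with
  | [] => 0
  | i :: L' => f i + Csum f L'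
  end.

Fixpoint Rsum {I : Type} (f : I -> R) (L : list I) : R :=
  match L with
  | [] => 0%R
  | i :: L' => (f i + Rsum f L')%R
  end.

(** Convergence along the finite subsets of [I], directed by inclusion; a finite subset is encoded
    as a list without repetition. *)
Definition has_sum {I : Type} (f : I -> C) (s : C) : Prop :=
  forall eps : R, (0 < eps)%R ->
  exists L0 : list I, forall L, NoDup L -> incl L0 L -> (Cmod (Csum f L - s) < eps)%R.

Definition summable {I : Type} (f : I -> C) : Prop :=
  exists M : R, forall L, NoDup L -> (Rsum (fun i => Cmod (f i)) L <= M)%R.

(** The index types are arbitrary, so that removing repetitions from a list rests on a classical
    decision of equality. *)
Definition eq_dec_classic {I : Type} (x y : I) : {x = y} + {x <> y} :=
  excluded_middle_informative (x = y).

Definition dedup {I : Type} (L : list I) : list I := nodup eq_dec_classic L.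

Lemma NoDup_dedup {I : Type} (L : list I) : NoDup (dedup L).
Proof. apply NoDup_nodup. Qed.

Lemma incl_dedup {I : Type} (L L' : list I) : incl L L' -> incl L (dedup L').
Proof. intros H x Hx. apply nodup_In. auto. Qed.

Lemma Csum_ext {I : Type} (f g : I -> C) L :
  (forall i, In i L -> f i = g i) -> Csum f L = Csum g L.
Proof.
  induction L as [|i L IH]; intros H; simpl; auto.
  rewrite H by (left; auto). rewrite IH; auto. intros j Hj. apply H. right; auto.
Qed.

Lemma Rsum_le {I : Type} (f g : I -> R) L :
  (forall i, In i L -> f i <= g i)%R -> (Rsum f L <= Rsum g L)%R.
Proof.
  induction L as [|i L IH]; intros H; simpl; [lra|].
  apply Rplus_le_compat; [apply H; left; auto|].
  apply IH. intros j Hj. apply H. right; auto.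
Qed.

Lemma Csum_plus {I : Type} (f g : I -> C) L :
  Csum (fun i => f i + g i) L = Csum f L + Csum g L.
Proof. induction L as [|i L IH]; simpl; [ring|]. rewrite IH. ring. Qed.

Lemma Csum_minus {I : Type} (f g : I -> C) L :
  Csum (fun i => f i - g i) L = Csum f L - Csum g L.
Proof. induction L as [|i L IH]; simpl; [ring|]. rewrite IH. ring. Qed.

Lemma Csum_scal {I : Type} (c : C) (f : I -> C) L :
  Csum (fun i => c * f i) L = c * Csum f L.
Proof. induction L as [|i L IH]; simpl; [ring|]. rewrite IH. ring. Qed.

Lemma Rsum_scal {I : Type} (c : R) (f : I -> R) L :
  Rsum (fun i => c * f i)%R L = (c * Rsum f L)%R.
Proof. induction L as [|i L IH]; simpl; [ring|]. rewrite IH. ring. Qed.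

Lemma Rsum_plus {I : Type} (f g : I -> R) L :
  Rsum (fun i => f i + g i)%R L = (Rsum f L + Rsum g L)%R.
Proof. induction L as [|i L IH]; simpl; [ring|]. rewrite IH. ring. Qed.

Lemma Csum_app {I : Type} (f : I -> C) L L' :
  Csum f (L ++ L') = Csum f L + Csum f L'.
Proof. induction L as [|i L IH]; simpl; [ring|]. rewrite IH. ring. Qed.

Lemma Rsum_app {I : Type} (f : I -> R) L L' :
  Rsum f (L ++ L') = (Rsum f L + Rsum f L')%R.
Proof. induction L as [|i L IH]; simpl; [ring|]. rewrite IH. ring. Qed.

Lemma Csum_perm {I : Type} (f : I -> C) L L' :
  Permutation L L' -> Csum f L = Csum f L'.
Proof. induction 1; simpl; try congruence. ring. Qed.

Lemma Rsum_perm {I : Type} (f : I -> R) L L' :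
  Permutation L L' -> Rsum f L = Rsum f L'.
Proof. induction 1; simpl; try congruence. ring. Qed.

Lemma Csum_map {I J : Type} (f : J -> C) (phi : I -> J) L :
  Csum (fun i => f (phi i)) L = Csum f (map phi L).
Proof. induction L as [|i L IH]; simpl; congruence. Qed.

Lemma Rsum_map {I J : Type} (f : J -> R) (phi : I -> J) L :
  Rsum (fun i => f (phi i)) L = Rsum f (map phi L).
Proof. induction L as [|i L IH]; simpl; congruence. Qed.

Lemma Csum_prod {I J : Type} (f : I * J -> C) L L' :
  Csum f (list_prod L L') = Csum (fun i => Csum (fun j => f (i, j)) L') L.
Proof.
  induction L as [|i L IH]; simpl; auto.
  rewrite Csum_app, IH, <- Csum_map. reflexivity.
Qed.

Lemma Rsum_prod {I J : Type} (f : I * J -> R) L L' :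
  Rsum f (list_prod L L') = Rsum (fun i => Rsum (fun j => f (i, j)) L') L.
Proof.
  induction L as [|i L IH]; simpl; auto.
  rewrite Rsum_app, IH, <- Rsum_map. reflexivity.
Qed.

Lemma Cmod_Csum {I : Type} (f : I -> C) L :
  (Cmod (Csum f L) <= Rsum (fun i => Cmod (f i)) L)%R.
Proof.
  induction L as [|i L IH]; simpl; [rewrite Cmod_0; lra|].
  eapply Rle_trans; [apply Cmod_triangle|]. lra.
Qed.

Lemma Rsum_nonneg {I : Type} (f : I -> R) L :
  (forall i, 0 <= f i)%R -> (0 <= Rsum f L)%R.
Proof.
  intros H. induction L as [|i L IH]; simpl; [lra|]. specialize (H i). lra.
Qed.

Lemma incl_split {I : Type} (L L' : list I) :
  NoDup L -> NoDup L' -> incl L L' ->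
  exists L'', Permutation L' (L ++ L'') /\ NoDup L'' /\
    (forall i, In i L'' -> ~ In i L).
Proof.
  revert L'. induction L as [|i L IH]; intros L' HL HL' Hi.
  - exists L'. repeat split; simpl; auto.
  - inversion HL; subst.
    destruct (in_split i L') as (l1 & l2 & ->); [apply Hi; left; auto|].
    assert (HP : Permutation (l1 ++ i :: l2) (i :: l1 ++ l2))
      by (symmetry; apply Permutation_middle).
    assert (HN : NoDup (i :: l1 ++ l2)) by (eapply Permutation_NoDup; eauto).
    inversion HN; subst.
    destruct (IH (l1 ++ l2)) as (L'' & H5 & H6 & H7); auto.
    { intros x Hx. assert (In x (i :: l1 ++ l2)) as Hx'.
      { eapply Permutation_in; [apply HP|]. apply Hi. right; auto. }
      destruct Hx' as [->|]; [contradiction|auto]. }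
    exists L''. split; [|split]; auto.
    + rewrite HP. simpl. constructor. auto.
    + intros x Hx [->|Hx']; [|eapply H7; eauto].
      apply H3. eapply Permutation_in; [symmetry; apply H5|]. apply in_or_app; auto.
Qed.

Lemma Rsum_incl {I : Type} (f : I -> R) (L L' : list I) :
  (forall i, 0 <= f i)%R -> NoDup L -> NoDup L' -> incl L L' ->
  (Rsum f L <= Rsum f L')%R.
Proof.
  intros Hf HL HL' Hi.
  destruct (incl_split L L' HL HL' Hi) as (L'' & HP & _ & _).
  rewrite (Rsum_perm f _ _ HP), Rsum_app.
  pose proof (Rsum_nonneg f L'' Hf). lra.
Qed.

Lemma NoDup_list_prod {I J : Type} (L : list I) (L' : list J) :
  NoDup L -> NoDup L' -> NoDup (list_prod L L').
Proof.
  intros HL HL'. induction HL as [|i L Hi HL IH]; simpl; [constructor|].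
  apply NoDup_app; auto.
  - apply FinFun.Injective_map_NoDup; auto. intros x y H. congruence.
  - intros [a b] Hab Hab'. apply in_map_iff in Hab. destruct Hab as (j & Hj & _).
    apply in_prod_iff in Hab'. destruct Hab' as [Ha _]. congruence.
Qed.

Lemma has_sum_ext {I : Type} (f g : I -> C) s :
  (forall i, f i = g i) -> has_sum f s -> has_sum g s.
Proof.
  intros H Hf eps He. destruct (Hf eps He) as [L0 H0]. exists L0. intros L HL Hi.
  rewrite <- (Csum_ext f g); auto.
Qed.

Lemma Ceq_eps (a b : C) : (forall eps, 0 < eps -> Cmod (a - b) <= eps)%R -> a = b.
Proof.
  intros H. assert (Cmod (a - b) = 0)%R as H0.
  { apply Rle_antisym; [|apply Cmod_ge_0].
    apply le_epsilon. intros eps He. specialize (H eps He). lra. }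
  apply Cmod_eq_0 in H0. replace a with ((a - b) + b) by ring. rewrite H0. ring.
Qed.

Lemma has_sum_unique {I : Type} (f : I -> C) s s' :
  has_sum f s -> has_sum f s' -> s = s'.
Proof.
  intros H H'. apply Ceq_eps. intros eps He.
  destruct (H (eps / 2)%R) as [L0 H0]; [lra|].
  destruct (H' (eps / 2)%R) as [L1 H1]; [lra|].
  pose (L := dedup (L0 ++ L1)).
  specialize (H0 L (NoDup_dedup _) (incl_dedup _ _ (incl_appl _ (incl_refl _)))).
  specialize (H1 L (NoDup_dedup _) (incl_dedup _ _ (incl_appr _ (incl_refl _)))).
  replace (s - s') with (- (Csum f L - s) + (Csum f L - s')) by ring.
  eapply Rle_trans; [apply Cmod_triangle|]. rewrite Cmod_opp. lra.
Qed.

Lemma has_sum_plus {I : Type} (f g : I -> C) s t :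
  has_sum f s -> has_sum g t -> has_sum (fun i => f i + g i) (s + t).
Proof.
  intros H H' eps He.
  destruct (H (eps / 2)%R) as [L0 H0]; [lra|].
  destruct (H' (eps / 2)%R) as [L1 H1]; [lra|].
  exists (L0 ++ L1). intros L HL Hi.
  specialize (H0 L HL (fun x Hx => Hi x (in_or_app _ _ _ (or_introl Hx)))).
  specialize (H1 L HL (fun x Hx => Hi x (in_or_app _ _ _ (or_intror Hx)))).
  rewrite Csum_plus.
  replace (Csum f L + Csum g L - (s + t)) with ((Csum f L - s) + (Csum g L - t)) by ring.
  eapply Rle_lt_trans; [apply Cmod_triangle|]. lra.
Qed.

Lemma has_sum_scal {I : Type} (c : C) (f : I -> C) s :
  has_sum f s -> has_sum (fun i => c * f i) (c * s).
Proof.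
  intros H eps He.
  pose proof (Cmod_ge_0 c) as Hc.
  destruct (H (eps / (Cmod c + 1))%R) as [L0 H0]; [apply Rdiv_lt_0_compat; lra|].
  exists L0. intros L HL Hi. specialize (H0 L HL Hi).
  rewrite Csum_scal. replace (c * Csum f L - c * s) with (c * (Csum f L - s)) by ring.
  rewrite Cmod_mult.
  apply Rle_lt_trans with (Cmod c * (eps / (Cmod c + 1)))%R.
  - apply Rmult_le_compat_l; lra.
  - apply Rmult_lt_reg_r with (Cmod c + 1)%R; [lra|]. field_simplify; nra.
Qed.

Lemma has_sum_opp {I : Type} (f : I -> C) s :
  has_sum f s -> has_sum (fun i => - f i) (- s).
Proof.
  intros H. replace (- s) with (- (1) * s) by ring.
  eapply has_sum_ext; [|apply has_sum_scal, H]. intros i; simpl; ring.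
Qed.

Lemma has_sum_minus {I : Type} (f g : I -> C) s t :
  has_sum f s -> has_sum g t -> has_sum (fun i => f i - g i) (s - t).
Proof. intros H H'. apply has_sum_plus; [|apply has_sum_opp]; auto. Qed.

Lemma has_sum_finite {I : Type} (f : I -> C) (L0 : list I) :
  NoDup L0 -> (forall i, ~ In i L0 -> f i = 0) -> has_sum f (Csum f L0).
Proof.
  intros HN H0 eps He. exists L0. intros L HL Hi.
  destruct (incl_split L0 L HN HL Hi) as (L' & HP & _ & Hd).
  rewrite (Csum_perm f _ _ HP), Csum_app.
  rewrite (Csum_ext f (fun _ => 0 * 0) L').
  - rewrite Csum_scal. replace (_ - _) with (RtoC 0) by ring. rewrite Cmod_0. auto.
  - intros i Hi'. rewrite H0; [ring|auto].
Qed.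

Lemma has_sum_single {I : Type} (f : I -> C) (i0 : I) :
  (forall i, i <> i0 -> f i = 0) -> has_sum f (f i0).
Proof.
  intros H. replace (f i0) with (Csum f [i0]) by (simpl; ring).
  apply has_sum_finite; [repeat constructor; auto|].
  intros i Hi. apply H. intros ->. apply Hi. left; auto.
Qed.

Lemma has_sum_bool (f : bool -> C) : has_sum f (f true + f false).
Proof.
  replace (f true + f false) with (Csum f [true; false]) by (simpl; ring).
  apply has_sum_finite.
  - repeat constructor; simpl; intuition discriminate.
  - intros [|] H; exfalso; apply H; simpl; auto.
Qed.

Lemma has_sum_reindex {I J : Type} (phi : I -> J) (psi : J -> I) (f : J -> C) s :
  (forall i, psi (phi i) = i) -> (forall j, phi (psi j) = j) ->
  has_sum f s -> has_sum (fun i => f (phi i)) s.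
Proof.
  intros H1 H2 H eps He. destruct (H eps He) as [L0 H0].
  exists (map psi L0). intros L HL Hi. rewrite Csum_map. apply H0.
  - apply FinFun.Injective_map_NoDup; auto.
    intros x y Hxy. rewrite <- (H1 x), <- (H1 y). congruence.
  - intros j Hj. rewrite <- (H2 j). apply in_map. apply Hi. apply in_map. auto.
Qed.

(** Finitely many thresholds are met at once by their union. This supplies one set of columns that
    serves all rows of a finite rectangle. *)
Lemma choose_list {I J : Type} (P : I -> list J -> Prop) (L : list I) :
  (forall i, exists J0, forall K, NoDup K -> incl J0 K -> P i K) ->
  forall J1, exists K, NoDup K /\ incl J1 K /\ (forall i, In i L -> P i K).
Proof.
  intros H.
  assert (exists J0, forall K, NoDup K -> incl J0 K -> forall i, In i L -> P i K) as [J0 H0].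
  { induction L as [|i L [J0 IH]].
    - exists []. intros K _ _ i [].
    - destruct (H i) as [J2 H2]. exists (J2 ++ J0). intros K HK Hi j [<-|Hj].
      + apply H2; auto. intros x Hx. apply Hi, in_or_app. auto.
      + apply IH; auto. intros x Hx. apply Hi, in_or_app. auto. }
  intros J1. exists (dedup (J0 ++ J1)). split; [apply NoDup_dedup|]. split.
  - apply incl_dedup, incl_appr, incl_refl.
  - apply H0; [apply NoDup_dedup|]. apply incl_dedup, incl_appl, incl_refl.
Qed.

Lemma Rsum_const {I : Type} (c : R) (L : list I) :
  Rsum (fun _ => c) L = (INR (length L) * c)%R.
Proof.
  induction L as [|i L IH]; [simpl; ring|].
  cbn [Rsum length]. rewrite IH, S_INR. ring.
Qed.

(** A finite set of rows is completed to a rectangle that contains [L0] and whose columns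
    approximate each row sum within [d]; the total error, [d] times the number of rows, stays below
    eps / 2. *)
Lemma has_sum_fubini {I J : Type} (f : I * J -> C) (g : I -> C) s :
  has_sum f s -> (forall i, has_sum (fun j => f (i, j)) (g i)) -> has_sum g s.
Proof.
  intros H Hg eps He.
  destruct (H (eps / 2)%R) as [L0 H0]; [lra|].
  exists (map fst L0). intros L HL Hi.
  pose (d := (eps / 2 / (INR (length L) + 1))%R).
  pose proof (pos_INR (length L)) as Hpos.
  assert (Hd : (0 < d)%R) by (unfold d; repeat apply Rdiv_lt_0_compat; lra).
  destruct (choose_list (fun i K => (Cmod (Csum (fun j => f (i, j)) K - g i) < d)%R) L
              (fun i => Hg i d Hd) (map snd L0)) as (K & HK & HK1 & HK2).
  specialize (H0 (list_prod L K) (NoDup_list_prod _ _ HL HK)).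
  rewrite Csum_prod in H0.
  replace (Csum g L - s) with
    ((Csum g L - Csum (fun i => Csum (fun j => f (i, j)) K) L)
     + (Csum (fun i => Csum (fun j => f (i, j)) K) L - s)) by ring.
  eapply Rle_lt_trans; [apply Cmod_triangle|].
  assert (Cmod (Csum g L - Csum (fun i => Csum (fun j => f (i, j)) K) L) <= eps / 2)%R.
  { rewrite <- Csum_minus. eapply Rle_trans; [apply Cmod_Csum|].
    apply Rle_trans with (Rsum (fun _ : I => d) L).
    - apply Rsum_le. intros i Hi'. specialize (HK2 i Hi').
      rewrite <- Cmod_opp. replace (- _) with (Csum (fun j => f (i, j)) K - g i) by ring. lra.
    - rewrite Rsum_const. unfold d.
      apply Rmult_le_reg_r with (INR (length L) + 1)%R; [lra|]. field_simplify; nra. }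
  assert (Hincl : incl L0 (list_prod L K)).
  { intros [i j] Hij. apply in_prod.
    - apply Hi. apply (in_map fst) in Hij. auto.
    - apply HK1. apply (in_map snd) in Hij. auto. }
  specialize (H0 Hincl). lra.
Qed.

Lemma summable_le {I : Type} (f g : I -> C) :
  (forall i, Cmod (f i) <= Cmod (g i))%R -> summable g -> summable f.
Proof.
  intros H [M HM]. exists M. intros L HL.
  eapply Rle_trans; [apply Rsum_le; intros i _; apply H|]. auto.
Qed.

Lemma summable_ext {I : Type} (f g : I -> C) :
  (forall i, f i = g i) -> summable f -> summable g.
Proof. intros H. apply summable_le. intros i. rewrite H. lra. Qed.

Lemma summable_scal {I : Type} (c : C) (f : I -> C) :
  summable f -> summable (fun i => c * f i).
Proof.
  intros [M HM]. exists (Cmod c * M)%R. intros L HL.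
  eapply Rle_trans; [apply Rsum_le; intros i _; right; apply Cmod_mult|].
  rewrite Rsum_scal. apply Rmult_le_compat_l; [apply Cmod_ge_0|auto].
Qed.

Lemma summable_plus {I : Type} (f g : I -> C) :
  summable f -> summable g -> summable (fun i => f i + g i).
Proof.
  intros [M HM] [M' HM']. exists (M + M')%R. intros L HL.
  eapply Rle_trans; [apply Rsum_le; intros i _; apply Cmod_triangle|].
  rewrite Rsum_plus. specialize (HM L HL). specialize (HM' L HL). lra.
Qed.

Lemma summable_minus {I : Type} (f g : I -> C) :
  summable f -> summable g -> summable (fun i => f i - g i).
Proof.
  intros Hf Hg. apply (summable_ext (fun i => f i + - (1) * g i)).
  - intros i. ring.
  - apply summable_plus; [|apply summable_scal]; auto.
Qed.

Lemma summable_inj {I J : Type} (phi : I -> J) (f : J -> C) :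
  (forall x y, phi x = phi y -> x = y) -> summable f -> summable (fun i => f (phi i)).
Proof.
  intros Hi [M HM]. exists M. intros L HL.
  rewrite (Rsum_map (fun j => Cmod (f j)) phi). apply HM.
  apply FinFun.Injective_map_NoDup; auto.
Qed.

Lemma summable_prod {I J : Type} (f : I -> C) (g : J -> C) :
  summable f -> summable g -> summable (fun p => f (fst p) * g (snd p)).
Proof.
  intros [M HM] [M' HM']. exists (M * M')%R. intros L HL.
  pose (A := dedup (map fst L)). pose (B := dedup (map snd L)).
  apply Rle_trans with
    (Rsum (fun p => Cmod (f (fst p) * g (snd p))) (list_prod A B)).
  - apply Rsum_incl; auto.
    + intros; apply Cmod_ge_0.
    + apply NoDup_list_prod; apply NoDup_dedup.
    + intros [i j] Hij. apply in_prod; apply nodup_In;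
      [apply (in_map fst) in Hij | apply (in_map snd) in Hij]; auto.
  - rewrite Rsum_prod. simpl.
    apply Rle_trans with
      (Rsum (fun i => Rsum (fun j => Cmod (g j)) B * Cmod (f i))%R A).
    + apply Rsum_le. intros i _. rewrite Rmult_comm, <- Rsum_scal.
      apply Rsum_le. intros j _. rewrite Cmod_mult. lra.
    + rewrite Rsum_scal. rewrite Rmult_comm.
      apply Rmult_le_compat; try (apply Rsum_nonneg; intros; apply Cmod_ge_0).
      * apply HM, NoDup_dedup.
      * apply HM', NoDup_dedup.
Qed.

(** Finitely many row sums are approximated on a common rectangle, where the bound [M] of the double
    family applies. *)
Lemma summable_rows {I J : Type} (f : I * J -> C) (g : I -> C) :
  summable f -> (forall i, has_sum (fun j => f (i, j)) (g i)) -> summable g.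
Proof.
  intros [M HM] Hg. exists M. intros L HL. apply le_epsilon. intros eps He.
  pose (d := (eps / (INR (length L) + 1))%R).
  pose proof (pos_INR (length L)) as Hpos.
  assert (Hd : (0 < d)%R) by (unfold d; repeat apply Rdiv_lt_0_compat; lra).
  destruct (choose_list (fun i K => (Cmod (Csum (fun j => f (i, j)) K - g i) < d)%R) L
              (fun i => Hg i d Hd) []) as (K & HK & _ & HK2).
  specialize (HM (list_prod L K) (NoDup_list_prod _ _ HL HK)).
  rewrite Rsum_prod in HM.
  apply Rle_trans with
    (Rsum (fun i => Rsum (fun j => Cmod (f (i, j))) K + d)%R L).
  - apply Rsum_le. intros i Hi. specialize (HK2 i Hi). simpl in HK2.
    pose proof (Cmod_Csum (fun j => f (i, j)) K).
    replace (g i) with (Csum (fun j => f (i, j)) K - (Csum (fun j => f (i, j)) K - g i)) by ring.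
    eapply Rle_trans; [apply Cmod_triangle|]. rewrite Cmod_opp. lra.
  - rewrite Rsum_plus, Rsum_const.
    assert (INR (length L) * d <= eps)%R; [|lra].
    unfold d. apply Rmult_le_reg_r with (INR (length L) + 1)%R; [lra|]. field_simplify; nra.
Qed.

Lemma nonneg_has_sum {I : Type} (f : I -> R) (M : R) :
  (forall i, 0 <= f i)%R -> (forall L, NoDup L -> (Rsum f L <= M)%R) ->
  exists s : R, has_sum (fun i => RtoC (f i)) s.
Proof.
  intros Hf HM.
  pose (E := fun x => exists L, NoDup L /\ x = Rsum f L).
  destruct (completeness E) as [s [Hs1 Hs2]].
  - exists M. intros x (L & HL & ->). auto.
  - exists 0%R, []. split; [constructor|auto].
  - exists s. intros eps He.
    destruct (classic (exists L, NoDup L /\ (s - eps < Rsum f L)%R)) as [(L0 & HL0 & H0)|Hn].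
    + exists L0. intros L HL Hi.
      assert (Csum (fun i => RtoC (f i)) L = RtoC (Rsum f L)) as ->.
      { clear. induction L as [|i L IH]; simpl; auto. rewrite IH, RtoC_plus. auto. }
      rewrite <- RtoC_minus, Cmod_R.
      pose proof (Rsum_incl f L0 L Hf HL0 HL Hi).
      assert (Rsum f L <= s)%R by (apply Hs1; exists L; auto).
      apply Rabs_def1; lra.
    + exfalso. assert (s <= s - eps)%R; [|lra].
      apply Hs2. intros x (L & HL & ->).
      destruct (Rle_lt_dec (Rsum f L) (s - eps)); auto. exfalso. eauto.
Qed.

(** [f] is the difference of the nonnegative families |f| + f and |f|, whose finite sums are
    bounded. *)
Lemma real_has_sum {I : Type} (f : I -> R) :
  summable (fun i => RtoC (f i)) -> exists s : R, has_sum (fun i => RtoC (f i)) s.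
Proof.
  intros [M HM].
  destruct (nonneg_has_sum (fun i => Rabs (f i)) M) as [s Hs].
  - intros; apply Rabs_pos.
  - intros L HL. eapply Rle_trans; [|apply (HM L HL)].
    apply Rsum_le. intros i _. rewrite Cmod_R. lra.
  - destruct (nonneg_has_sum (fun i => Rabs (f i) + f i)%R (2 * M)) as [t Ht].
    + intros i. pose proof (Rabs_maj2 (f i)). lra.
    + intros L HL. apply Rle_trans with (2 * Rsum (fun i => Cmod (f i)) L)%R.
      * rewrite <- Rsum_scal. apply Rsum_le. intros i _. rewrite Cmod_R.
        pose proof (Rle_abs (f i)). lra.
      * specialize (HM L HL). lra.
    + exists (t - s)%R. rewrite RtoC_minus.
      eapply has_sum_ext; [|apply (has_sum_minus _ _ _ _ Ht Hs)].
      intros i. simpl. rewrite RtoC_plus. ring.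
Qed.

Lemma summable_has_sum {I : Type} (f : I -> C) :
  summable f -> exists s, has_sum f s.
Proof.
  intros H.
  destruct (real_has_sum (fun i => Re (f i))) as [a Ha].
  { eapply summable_le; [|apply H]. intros i. rewrite Cmod_R. simpl.
    eapply Rle_trans; [|apply Rmax_Cmod]. apply Rmax_l. }
  destruct (real_has_sum (fun i => Im (f i))) as [b Hb].
  { eapply summable_le; [|apply H]. intros i. rewrite Cmod_R. simpl.
    eapply Rle_trans; [|apply Rmax_Cmod]. apply Rmax_r. }
  exists (a + Ci * b). eapply has_sum_ext;
    [|apply (has_sum_plus _ _ _ _ Ha (has_sum_scal Ci _ _ Hb))].
  intros i. simpl. destruct (f i) as [u v]. unfold Ci, RtoC, Cplus, Cmult. simpl.
  f_equal; ring.
Qed.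

(** Absolute summability provides some sum [u] of the product family, and summation by rows
    identifies it. *)
Lemma has_sum_prod {I J : Type} (f : I -> C) (g : J -> C) s t :
  summable f -> summable g -> has_sum f s -> has_sum g t ->
  has_sum (fun p => f (fst p) * g (snd p)) (s * t).
Proof.
  intros Sf Sg Hf Hg.
  destruct (summable_has_sum _ (summable_prod f g Sf Sg)) as [u Hu].
  assert (has_sum (fun i => f i * t) u) as H1.
  { eapply has_sum_fubini; [apply Hu|]. intros i. simpl. apply has_sum_scal, Hg. }
  assert (has_sum (fun i => f i * t) (s * t)) as H2.
  { rewrite Cmult_comm. eapply has_sum_ext; [|apply has_sum_scal, Hf].
    intros i; simpl; ring. }
  rewrite (has_sum_unique _ _ _ H2 H1). auto.
Qed.

Lemma has_sum_tail {I : Type} (f : I -> C) (s : C) (L0 : list I) (eps : R) :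
  NoDup L0 -> has_sum f s ->
  (forall L, NoDup L -> (forall i, In i L -> ~ In i L0) ->
     (Rsum (fun i => Cmod (f i)) L <= eps)%R) ->
  (Cmod (Csum f L0 - s) <= eps)%R.
Proof.
  intros HN Hs Ht. apply le_epsilon. intros d Hd.
  destruct (Hs d Hd) as [L1 H1].
  pose (L := dedup (L0 ++ L1)).
  specialize (H1 L (NoDup_dedup _) (incl_dedup _ _ (incl_appr _ (incl_refl _)))).
  destruct (incl_split L0 L HN (NoDup_dedup _) (incl_dedup _ _ (incl_appl _ (incl_refl _))))
    as (L' & HP & HN' & Hd').
  rewrite (Csum_perm f _ _ HP), Csum_app in H1.
  replace (Csum f L0 - s) with ((Csum f L0 + Csum f L' - s) - Csum f L') by ring.
  eapply Rle_trans; [apply Cmod_triangle|]. rewrite Cmod_opp.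
  pose proof (Cmod_Csum f L'). specialize (Ht L' HN' Hd'). lra.
Qed.

(** Otherwise every finite set could be enlarged by a disjoint one of mass above [eps], and n
    enlargements would have mass at least n eps, against the bound [M]. *)
Lemma summable_tail {I : Type} (f : I -> C) (eps : R) :
  summable f -> (0 < eps)%R ->
  exists L0, NoDup L0 /\ forall L, NoDup L -> (forall i, In i L -> ~ In i L0) ->
     (Rsum (fun i => Cmod (f i)) L <= eps)%R.
Proof.
  intros [M HM] He. apply NNPP. intros Hn.
  assert (forall n : nat, exists L, NoDup L /\
            (INR n * eps <= Rsum (fun i => Cmod (f i)) L)%R) as Hbig.
  { induction n as [|n (L & HL & HLs)].
    - exists []. split; [constructor|]. simpl. lra.
    - destruct (classic (exists L', NoDup L' /\ (forall i, In i L' -> ~ In i L) /\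
                  (eps < Rsum (fun i => Cmod (f i)) L')%R)) as [(L' & H1 & H2 & H3)|H].
      + exists (L' ++ L). split.
        * apply NoDup_app; auto.
        * rewrite Rsum_app, S_INR. lra.
      + exfalso. apply Hn. exists L. split; auto. intros L' H1 H2.
        destruct (Rle_lt_dec (Rsum (fun i => Cmod (f i)) L') eps); auto.
        exfalso. eauto. }
  destruct (archimed_cor1 (eps / (Rabs M + 1))) as (n & Hn1 & Hn2).
  { apply Rdiv_lt_0_compat; auto. pose proof (Rabs_pos M). lra. }
  destruct (Hbig n) as (L & HL & HLs). specialize (HM L HL).
  assert (0 < INR n)%R by (apply lt_0_INR; auto).
  pose proof (Rle_abs M). pose proof (Rabs_pos M).
  assert (Rabs M + 1 < INR n * eps)%R; [|lra].
  apply Rmult_lt_reg_r with (/ INR n)%R; [apply Rinv_0_lt_compat; auto|].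
  replace (INR n * eps * / INR n)%R with eps by (field; lra).
  apply Rmult_lt_reg_r with (/ (Rabs M + 1))%R; [apply Rinv_0_lt_compat; lra|].
  replace ((Rabs M + 1) * / INR n * / (Rabs M + 1))%R with (/ INR n)%R by (field; lra).
  exact Hn1.
Qed.

(** * Limits of complex sequences and dominated convergence *)

Definition Ctends (u : nat -> C) (l : C) : Prop :=
  forall eps, (0 < eps)%R -> exists N, forall n, (N <= n)%nat -> (Cmod (u n - l) < eps)%R.

Lemma Ctends_unique u l l' : Ctends u l -> Ctends u l' -> l = l'.
Proof.
  intros H H'. apply Ceq_eps. intros eps He.
  destruct (H (eps / 2)%R) as [N HN]; [lra|].
  destruct (H' (eps / 2)%R) as [N' HN']; [lra|].
  specialize (HN (N + N')%nat ltac:(lia)). specialize (HN' (N + N')%nat ltac:(lia)).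
  replace (l - l') with (- (u (N + N')%nat - l) + (u (N + N')%nat - l')) by ring.
  eapply Rle_trans; [apply Cmod_triangle|]. rewrite Cmod_opp. lra.
Qed.

Lemma Ctends_ext u v l : (forall n, u n = v n) -> Ctends u l -> Ctends v l.
Proof.
  intros H Hu eps He. destruct (Hu eps He) as [N HN]. exists N. intros n Hn.
  rewrite <- H. auto.
Qed.

Lemma Ctends_const c : Ctends (fun _ => c) c.
Proof.
  intros eps He. exists 0%nat. intros n _.
  replace (c - c) with (RtoC 0) by ring. rewrite Cmod_0. auto.
Qed.

Lemma Ctends_plus u v a b :
  Ctends u a -> Ctends v b -> Ctends (fun n => u n + v n) (a + b).
Proof.
  intros H H' eps He.
  destruct (H (eps / 2)%R) as [N HN]; [lra|].
  destruct (H' (eps / 2)%R) as [N' HN']; [lra|].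
  exists (N + N')%nat. intros n Hn.
  specialize (HN n ltac:(lia)). specialize (HN' n ltac:(lia)).
  replace (u n + v n - (a + b)) with ((u n - a) + (v n - b)) by ring.
  eapply Rle_lt_trans; [apply Cmod_triangle|]. lra.
Qed.

Lemma Ctends_mult u v a b :
  Ctends u a -> Ctends v b -> Ctends (fun n => u n * v n) (a * b).
Proof.
  intros H H' eps He.
  pose proof (Cmod_ge_0 a) as Ha. pose proof (Cmod_ge_0 b) as Hb.
  pose (K := (Cmod a + Cmod b + 2)%R).
  pose (d := (Rmin 1 (eps / K))%R).
  assert (HK : (0 < K)%R) by (unfold K; lra).
  assert (Hd : (0 < d)%R).
  { unfold d. apply Rmin_pos; [lra|]. apply Rdiv_lt_0_compat; auto. }
  assert (Hd1 : (d <= 1)%R) by apply Rmin_l.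
  assert (Hd2 : (d * K <= eps)%R).
  { apply Rle_trans with (eps / K * K)%R.
    - apply Rmult_le_compat_r; [lra|apply Rmin_r].
    - right. field. lra. }
  destruct (H d Hd) as [N HN]. destruct (H' d Hd) as [N' HN'].
  exists (N + N')%nat. intros n Hn.
  specialize (HN n ltac:(lia)). specialize (HN' n ltac:(lia)).
  replace (u n * v n - a * b)
    with ((u n - a) * (v n - b) + ((u n - a) * b + a * (v n - b))) by ring.
  pose proof (Cmod_ge_0 (u n - a)). pose proof (Cmod_ge_0 (v n - b)).
  eapply Rle_lt_trans; [apply Cmod_triangle|].
  eapply Rle_lt_trans; [apply Rplus_le_compat_l, Cmod_triangle|].
  rewrite !Cmod_mult.
  apply Rlt_le_trans with (d * K)%R; auto. unfold K. nra.
Qed.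

Lemma Ctends_sub (u : nat -> C) (l : C) (phi : nat -> nat) :
  (forall n, (n <= phi n)%nat) -> Ctends u l -> Ctends (fun n => u (phi n)) l.
Proof.
  intros Hphi H eps He. destruct (H eps He) as [N HN].
  exists N. intros n Hn. apply HN. specialize (Hphi n). lia.
Qed.

(** Tannery's theorem: outside a finite set [g] has mass at most eps / 4, and on that set the
    convergence is termwise. *)
Lemma has_sum_dominated_convergence {I : Type} (f : nat -> I -> C) (g h : I -> C) (s : nat -> C) (t : C) :
  summable g -> (forall n i, Cmod (f n i) <= Cmod (g i))%R ->
  (forall i, Ctends (fun n => f n i) (h i)) ->
  (forall n, has_sum (f n) (s n)) -> has_sum h t -> Ctends s t.
Proof.
  intros Sg Hfg Hfh Hs Ht eps He.
  destruct (summable_tail g (eps / 4) Sg) as (L0 & HN & Htl); [lra|].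
  assert (Hhg : forall i, (Cmod (h i) <= Cmod (g i))%R).
  { intros i. apply le_epsilon. intros d Hd. destruct (Hfh i d Hd) as [N HN'].
    specialize (HN' N (le_n _)). specialize (Hfg N i).
    replace (h i) with (f N i - (f N i - h i)) by ring.
    eapply Rle_trans; [apply Cmod_triangle|]. rewrite Cmod_opp. lra. }
  assert (Hfin : Ctends (fun n => Csum (f n) L0) (Csum h L0)).
  { clear - Hfh. induction L0 as [|i L IH]; simpl.
    - apply Ctends_const.
    - apply Ctends_plus; auto. }
  destruct (Hfin (eps / 4)%R) as [N HN']; [lra|].
  exists N. intros n Hn. specialize (HN' n Hn).
  assert (Cmod (Csum (f n) L0 - s n) <= eps / 4)%R.
  { apply has_sum_tail; auto. intros L HL Hd.
    eapply Rle_trans; [apply Rsum_le; intros i _; apply Hfg|]. auto. }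
  assert (Cmod (Csum h L0 - t) <= eps / 4)%R.
  { apply has_sum_tail; auto. intros L HL Hd.
    eapply Rle_trans; [apply Rsum_le; intros i _; apply Hhg|]. auto. }
  replace (s n - t) with
    (- (Csum (f n) L0 - s n) + ((Csum (f n) L0 - Csum h L0) + (Csum h L0 - t))) by ring.
  eapply Rle_lt_trans; [apply Cmod_triangle|].
  rewrite Cmod_opp.
  eapply Rle_lt_trans; [apply Rplus_le_compat_l, Cmod_triangle|]. lra.
Qed.

(** * Sums over the integers *)

Lemma summable_bool (f : bool -> C) : summable f.
Proof.
  exists (Rsum (fun i => Cmod (f i)) [true; false]). intros L HL.
  apply Rsum_incl; auto.
  - intros; apply Cmod_ge_0.
  - repeat constructor; simpl; intuition discriminate.
  - intros [|] _; simpl; auto.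
Qed.

Lemma summable_geom (r : R) : (0 <= r < 1)%R -> summable (fun n : nat => RtoC (r ^ n)).
Proof.
  intros Hr. exists (/ (1 - r))%R. intros L HL.
  assert (Hseq : forall N, (Rsum (fun n => r ^ n)%R (seq 0 N) * (1 - r) = 1 - r ^ N)%R).
  { induction N as [|N IH]; [simpl; ring|].
    rewrite seq_S, Rsum_app. simpl. rewrite Rmult_plus_distr_r, IH. ring. }
  apply Rle_trans with (Rsum (fun n => r ^ n)%R L).
  { apply Rsum_le. intros i _. rewrite Cmod_R, Rabs_pos_eq; [lra|]. apply pow_le. lra. }
  apply Rle_trans with (Rsum (fun n => r ^ n)%R (seq 0 (S (list_max L)))).
  - apply Rsum_incl; auto.
    + intros; apply pow_le; lra.
    + apply seq_NoDup.
    + intros i Hi. apply in_seq. split; [lia|].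
      pose proof (proj1 (list_max_le L (list_max L)) (le_n _)) as H.
      rewrite Forall_forall in H. specialize (H i Hi). lia.
  - apply Rmult_le_reg_r with (1 - r)%R; [lra|]. rewrite Hseq, Rinv_l by lra.
    assert (0 <= r ^ S (list_max L))%R by (apply pow_le; lra). lra.
Qed.

Lemma exp_INR_opp (n : nat) : exp (- INR n) = (exp (-1) ^ n)%R.
Proof.
  induction n as [|n IH]; [simpl; rewrite Ropp_0; apply exp_0|].
  rewrite S_INR. simpl. rewrite <- IH, <- exp_plus. f_equal. ring.
Qed.

Lemma summable_exp_abs : summable (fun n : Z => RtoC (exp (- Rabs (IZR n)))).
Proof.
  pose (F := fun p : bool * nat => 1 * RtoC (exp (-1) ^ (snd p))).
  assert (HF : summable F).
  { apply (summable_prod (fun _ : bool => RtoC 1) (fun n => RtoC (exp (-1) ^ n))).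
    - apply summable_bool.
    - apply summable_geom. split; [left; apply exp_pos|].
      rewrite <- exp_0. apply exp_increasing. lra. }
  (* Sign and absolute value embed the integers in two copies of [nat], each carrying a geometric
     series. *)
  eapply summable_ext; [|apply (summable_inj (fun n : Z => (Z.ltb n 0, Z.abs_nat n)) F)]; auto.
  - intros n. unfold F. simpl. rewrite <- exp_INR_opp, INR_IZR_INZ, Zabs2Nat.id_abs, abs_IZR.
    ring.
  - intros x y H. injection H as H1 H2.
    destruct (Z.ltb_spec x 0), (Z.ltb_spec y 0); try discriminate; lia.
Qed.

(** The common dominating family: moduli of theta terms are exponentials of quadratic polynomials in
    n, and |n| absorbs the sign of their linear part. *)
Definition gauss (a b c : R) (n : Z) : R := exp (- a * IZR n ^ 2 + b * Rabs (IZR n) + c).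

Lemma summable_gauss (a b c : R) : (0 < a)%R -> summable (fun n => RtoC (gauss a b c n)).
Proof.
  intros Ha.
  (* By completing the square, (b + 1) t - a t^2 <= (b + 1)^2 / (4 a); taking b + 1 instead of b
     leaves a factor exp (- t), with t = |n|. *)
  pose (K := exp ((b + 1) ^ 2 / (4 * a) + c)).
  apply summable_le with (fun n : Z => RtoC K * RtoC (exp (- Rabs (IZR n)))).
  - intros n. unfold gauss. unfold K.
    rewrite Cmod_mult, !Cmod_R, !(Rabs_pos_eq (exp _)) by (left; apply exp_pos).
    rewrite <- exp_plus.
    assert (H : (- a * IZR n ^ 2 + b * Rabs (IZR n) + c
            <= (b + 1) ^ 2 / (4 * a) + c + - Rabs (IZR n))%R).
    { rewrite <- (pow2_abs (IZR n)). set (t := Rabs (IZR n)).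
      assert ((b + 1) ^ 2 / (4 * a) - (b + 1) * t + a * t ^ 2 =
              (2 * a * t - (b + 1)) ^ 2 / (4 * a))%R as E by (field; lra).
      assert (0 <= (2 * a * t - (b + 1)) ^ 2 / (4 * a))%R.
      { apply Rmult_le_pos; [apply pow2_ge_0|]. left. apply Rinv_0_lt_compat. lra. }
      lra. }
    destruct H as [H|H]; [left; apply exp_increasing; auto|right; rewrite H; auto].
  - apply summable_scal, summable_exp_abs.
Qed.

Lemma summable_gauss1 (f : Z -> C) (a b c : R) :
  (0 < a)%R -> (forall n, Cmod (f n) <= gauss a b c n)%R -> summable f.
Proof.
  intros Ha H. eapply summable_le; [|apply (summable_gauss a b c Ha)].
  intros n. unfold gauss in *. rewrite Cmod_R, (Rabs_pos_eq (exp _)); auto. left; apply exp_pos.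
Qed.

Lemma summable_gauss3 (f : Z * (Z * Z) -> C) (a b c : R) :
  (0 < a)%R ->
  (forall k l n, Cmod (f (k, (l, n))) <= gauss a b c k * (gauss a b 0 l * gauss a b 0 n))%R ->
  summable f.
Proof.
  intros Ha H.
  apply summable_le with
    (fun p => RtoC (gauss a b c (fst p)) *
              (fun p => RtoC (gauss a b 0 (fst p)) * RtoC (gauss a b 0 (snd p))) (snd p)).
  - intros [k [l n]]. simpl. unfold gauss in *.
    rewrite !Cmod_mult, !Cmod_R, !(Rabs_pos_eq (exp _)) by (left; apply exp_pos). auto.
  - apply (summable_prod (fun k => RtoC (gauss a b c k))
      (fun p => RtoC (gauss a b 0 (fst p)) * RtoC (gauss a b 0 (snd p)))).
    + apply summable_gauss; auto.
    + apply (summable_prod (fun k => RtoC (gauss a b 0 k)) (fun k => RtoC (gauss a b 0 k)));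
      apply summable_gauss; auto.
Qed.

(** * Unconditional sums and the componentwise limits and series *)

Lemma Ctends_lim (u : nat -> C) (l : C) : Ctends u l -> CLim_seq u = l.
Proof.
  intros H. unfold CLim_seq.
  rewrite (is_lim_seq_unique (fun n => Re (u n)) (Re l)).
  rewrite (is_lim_seq_unique (fun n => Im (u n)) (Im l)).
  - simpl. destruct l; auto.
  - apply is_lim_seq_spec. intros eps. destruct (H eps (cond_pos eps)) as [N HN].
    exists N. intros n Hn. eapply Rle_lt_trans; [|apply (HN n Hn)].
    eapply Rle_trans; [|apply Rmax_Cmod]. simpl. apply Rmax_r.
  - apply is_lim_seq_spec. intros eps. destruct (H eps (cond_pos eps)) as [N HN].
    exists N. intros n Hn. eapply Rle_lt_trans; [|apply (HN n Hn)].
    eapply Rle_trans; [|apply Rmax_Cmod]. simpl. apply Rmax_l.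
Qed.

Lemma has_sum_seq (f : nat -> C) (s : C) :
  has_sum f s -> Ctends (fun n => Csum f (seq 0 n)) s.
Proof.
  intros H eps He. destruct (H eps He) as [L0 H0].
  exists (S (list_max L0)). intros n Hn. apply H0; [apply seq_NoDup|].
  intros i Hi. apply in_seq. split; [lia|].
  pose proof (proj1 (list_max_le L0 (list_max L0)) (le_n _)) as Hm.
  rewrite Forall_forall in Hm. specialize (Hm i Hi). lia.
Qed.

Lemma has_sum_CSeries (f : nat -> C) (s : C) : has_sum f s -> CSeries f = s.
Proof.
  intros H.
  pose proof (Ctends_sub _ _ S ltac:(intros; lia) (has_sum_seq f s H)) as HT.
  cbv beta in HT.
  assert (Hsum : forall n, (sum_n (fun k => Re (f k)) n, sum_n (fun k => Im (f k)) n)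
                           = Csum f (seq 0 (S n))).
  { induction n as [|n IH].
    - rewrite !sum_O. simpl. rewrite Cplus_0_r. destruct (f 0%nat); auto.
    - rewrite !sum_Sn, (seq_S (S n)), Csum_app, <- IH.
      apply injective_projections; simpl; unfold plus; simpl; unfold Re, Im; ring. }
  rewrite <- (Ctends_lim _ _ HT). unfold CSeries, CLim_seq, Series.
  rewrite (Lim_seq_ext (fun n => Re (Csum f (seq 0 (S n)))) (sum_n (fun k => Re (f k))))
    by (intros n; rewrite <- Hsum; reflexivity).
  rewrite (Lim_seq_ext (fun n => Im (Csum f (seq 0 (S n)))) (sum_n (fun k => Im (f k))))
    by (intros n; rewrite <- Hsum; reflexivity).
  reflexivity.
Qed.

(** The halves n >= 0 and n <= -1 are the two rows of a family indexed by [bool * nat], so summation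
    by rows adds them. *)
Lemma has_sum_CSeriesZ (f : Z -> C) (s : C) : summable f -> has_sum f s -> CSeriesZ f = s.
Proof.
  intros Sf Hf.
  pose (phi := fun p : bool * nat =>
    if fst p then Z.of_nat (snd p) else (- Z.of_nat (S (snd p)))%Z).
  pose (psi := fun n : Z =>
    if Z.leb 0 n then (true, Z.to_nat n) else (false, Z.to_nat (- n - 1))).
  assert (Hb : has_sum (fun p => f (phi p)) s).
  { apply (has_sum_reindex phi psi); auto.
    - intros [[|] n]; unfold phi, psi; cbn [fst snd].
      + replace (Z.leb 0 (Z.of_nat n)) with true by (symmetry; apply Z.leb_le; lia).
        f_equal. lia.
      + replace (Z.leb 0 (- Z.of_nat (S n))) with false by (symmetry; apply Z.leb_gt; lia).
        f_equal. lia.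
    - intros n. unfold phi, psi. destruct (Z.leb_spec 0 n); cbn [fst snd]; lia. }
  destruct (summable_has_sum (fun n : nat => f (Z.of_nat n))) as [a Ha].
  { apply (summable_inj Z.of_nat); auto. intros; lia. }
  destruct (summable_has_sum (fun n : nat => f (- Z.of_nat (S n))%Z)) as [b Hb'].
  { apply (summable_inj (fun n => (- Z.of_nat (S n))%Z)); auto. intros; lia. }
  unfold CSeriesZ. rewrite (has_sum_CSeries _ _ Ha), (has_sum_CSeries _ _ Hb').
  symmetry. apply (has_sum_unique (fun b0 : bool => if b0 then a else b)).
  - eapply has_sum_fubini; [apply Hb|]. intros [|]; auto.
  - apply (has_sum_bool (fun b0 : bool => if b0 then a else b)).
Qed.

(** * The exponential e^{pi i u}, for which the signs (-1)^n are exponentials as well *)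

Definition epi (u : C) : C := Cexp (PI * Ci * u).

Lemma Cexp_plus u v : Cexp (u + v) = Cexp u * Cexp v.
Proof.
  destruct u as [a b], v as [c d]. unfold Cexp, Cmult, Cplus, Re, Im; cbn [fst snd].
  rewrite exp_plus, cos_plus, sin_plus. f_equal; ring.
Qed.

Lemma Cmod_Cexp u : Cmod (Cexp u) = exp (Re u).
Proof.
  unfold Cmod, Cexp. simpl.
  replace (_ + _)%R with ((exp (fst u)) ^ 2 * (Rsqr (sin (snd u)) + Rsqr (cos (snd u))))%R
    by (unfold Rsqr, Im, Re; ring).
  rewrite sin2_cos2, Rmult_1_r, sqrt_pow2; auto. left; apply exp_pos.
Qed.

Lemma epi_plus u v : epi (u + v) = epi u * epi v.
Proof. unfold epi. rewrite <- Cexp_plus. f_equal. ring. Qed.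

Lemma Cmod_epi u : Cmod (epi u) = exp (- (PI * Im u)).
Proof. unfold epi. rewrite Cmod_Cexp. f_equal. unfold Re, Im. simpl. ring. Qed.

Lemma epi_neq_0 u : epi u <> 0.
Proof.
  intros H. pose proof (Cmod_epi u) as E. rewrite H, Cmod_0 in E.
  pose proof (exp_pos (- (PI * Im u))). lra.
Qed.

Lemma epi_0 : epi 0 = 1.
Proof.
  unfold epi, Cexp. simpl. apply injective_projections; simpl;
  rewrite ?Rmult_0_r, ?Rmult_0_l, ?Rminus_0_r, ?Rplus_0_r, ?exp_0, ?cos_0, ?sin_0; ring.
Qed.

Lemma epi_1 : epi 1 = -1.
Proof.
  unfold epi, Cexp. simpl.
  replace (_ - _)%R with 0%R by ring.
  replace ((PI * 0 - 0 * 1) * 0 + (PI * 1 + 0 * 0) * 1)%R with PI by ring.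
  rewrite exp_0, cos_PI, sin_PI. apply injective_projections; simpl; ring.
Qed.

Lemma epi_half : epi (1 / 2) = Ci.
Proof.
  unfold epi. replace (PI * Ci * (1 / 2)) with ((0, PI / 2)%R : C)
    by (apply injective_projections; simpl; field).
  unfold Cexp. simpl.
  rewrite exp_0, cos_PI2, sin_PI2. apply injective_projections; simpl; ring.
Qed.

Lemma epi_opp u : epi (- u) = / epi u.
Proof.
  pose proof (epi_neq_0 u).
  replace (epi (- u)) with (epi (- u) * epi u / epi u) by (field; auto).
  rewrite <- epi_plus. replace (- u + u) with (RtoC 0) by ring.
  rewrite epi_0. field. auto.
Qed.

Lemma epi_add_1 u : epi (u + 1) = - epi u.
Proof. rewrite epi_plus, epi_1. ring. Qed.

Lemma epi_even (k : Z) : epi (2 * IZR k) = 1.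
Proof.
  assert (H : forall n : nat, epi (2 * INR n) = 1).
  { induction n as [|n IH]; [simpl; rewrite Cmult_0_r; apply epi_0|].
    rewrite S_INR, RtoC_plus. replace (2 * (INR n + 1)) with (2 * INR n + 1 + 1) by ring.
    rewrite !epi_add_1, IH. ring. }
  destruct (Z_le_gt_dec 0 k).
  - rewrite <- (Z2Nat.id k), <- INR_IZR_INZ by lia. apply H.
  - replace (2 * IZR k) with (- (2 * INR (Z.to_nat (- k)))).
    + rewrite epi_opp, H. field.
    + rewrite INR_IZR_INZ, Z2Nat.id, opp_IZR, RtoC_opp by lia. ring.
Qed.

Ltac cast := repeat progress rewrite ?plus_IZR, ?minus_IZR, ?mult_IZR, ?opp_IZR, ?RtoC_plus,
  ?RtoC_minus, ?RtoC_mult, ?RtoC_opp.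
Ltac cring := cast; field.

(** Together with [epi_neg], this reduces an equality between theta terms to a polynomial identity
    in the exponents, once the integer [k] has been named. *)
Lemma epi_eq (u v : C) (k : Z) : u = v + 2 * IZR k -> epi u = epi v.
Proof. intros ->. rewrite epi_plus, epi_even. ring. Qed.

Lemma epi_neg (u v : C) (k : Z) : u = v + 2 * IZR k + 1 -> epi u = - epi v.
Proof. intros ->. rewrite epi_add_1, epi_plus, epi_even. ring. Qed.

(** * The Jacobi triple product *)

Lemma exp_le_compat x y : (x <= y)%R -> (exp x <= exp y)%R.
Proof. intros [H| ->]; [left; apply exp_increasing; auto|lra]. Qed.

Lemma gauss_bound (A B D : R) (n : Z) :
  (exp (- (PI * (A * IZR n ^ 2 + B * IZR n + D)))
   <= gauss (PI * A) (PI * Rabs B) (- (PI * D)) n)%R.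
Proof.
  apply exp_le_compat. pose proof PI_RGT_0.
  assert (- (B * IZR n) <= Rabs B * Rabs (IZR n))%R.
  { rewrite <- Rabs_mult. apply Rabs_maj2. }
  nra.
Qed.

Lemma summable_epi (f : Z -> C) (A B D : R) :
  (0 < A)%R -> (forall n, Im (f n) = (A * IZR n ^ 2 + B * IZR n + D)%R) ->
  summable (fun n => epi (f n)).
Proof.
  intros HA Hf. apply (summable_gauss1 _ (PI * A) (PI * Rabs B) (- (PI * D))).
  - apply Rmult_lt_0_compat; auto. apply PI_RGT_0.
  - intros n. rewrite Cmod_epi, Hf. apply gauss_bound.
Qed.

(** * Convergence of infinite products *)

Lemma Cprod_ext (a b : nat -> C) N : (forall n, a n = b n) -> Cprod a N = Cprod b N.
Proof. intros H. induction N as [|N IH]; simpl; congruence. Qed.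

Lemma Cprod_mult (a b : nat -> C) N :
  Cprod (fun n => a n * b n) N = Cprod a N * Cprod b N.
Proof. induction N as [|N IH]; simpl; [ring|]. rewrite IH. ring. Qed.

Lemma Cprod_bounded (a : nat -> C) :
  summable a -> exists M, (0 < M)%R /\ forall N, (Cmod (Cprod (fun n => 1 + a n)%C N) <= M)%R.
Proof.
  intros [M HM]. exists (exp M). split; [apply exp_pos|]. intros N.
  apply Rle_trans with (exp (Rsum (fun n => Cmod (a n)) (seq 0 N))).
  - induction N as [|N IH]; [simpl; rewrite exp_0, Cmod_1; lra|].
    rewrite seq_S, Rsum_app, exp_plus. simpl. rewrite Cmod_mult.
    apply Rmult_le_compat; auto; try apply Cmod_ge_0.
    eapply Rle_trans; [apply Cmod_triangle|]. rewrite Cmod_1, Rplus_0_r. apply exp_ineq1_le.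
  - apply exp_le_compat. apply HM, seq_NoDup.
Qed.

(** The partial products telescope, P_{n+1} - P_n = P_n a_n, and the differences are summable
    because the P_n are bounded. *)
Lemma Cprod_converges (a : nat -> C) :
  summable a -> exists l, Ctends (Cprod (fun n => 1 + a n)) l.
Proof.
  intros Ha. destruct (Cprod_bounded a Ha) as (M & HM & Hb).
  destruct (summable_has_sum (fun n => Cprod (fun k => 1 + a k) n * a n)) as [s Hs].
  { apply summable_le with (fun n => RtoC M * a n); [|apply summable_scal; auto].
    intros n. rewrite !Cmod_mult, Cmod_R, (Rabs_pos_eq M) by lra.
    apply Rmult_le_compat_r; auto. apply Cmod_ge_0. }
  exists (1 + s).
  eapply Ctends_ext; [|apply (Ctends_plus _ _ _ _ (Ctends_const 1) (has_sum_seq _ _ Hs))].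
  intros n. induction n as [|n IH]; [simpl; ring|].
  rewrite seq_S, Csum_app, Cplus_assoc, IH. simpl. ring.
Qed.

(** The infinite product (a; q)_oo with a = e^{pi i w}, q = e^{2 pi i tau}. *)
Definition poch (w tau : C) : C := CLim_seq (Cprod (fun n => 1 - epi (w + 2 * tau * INR n))).

Lemma summable_epi_nat (w tau : C) :
  (0 < Im tau)%R -> summable (fun n => epi (w + 2 * tau * INR n)).
Proof.
  intros Ht. pose proof PI_RGT_0.
  pose (r := exp (- (2 * PI * Im tau))).
  apply summable_le with (fun n => epi w * RtoC (r ^ n)).
  - intros n. rewrite Cmod_mult, Cmod_R, !Cmod_epi.
    rewrite Rabs_pos_eq by (apply pow_le; left; apply exp_pos).
    right. induction n as [|n IH].
    + simpl. rewrite Rmult_1_r. do 2 f_equal. unfold Im. simpl. ring.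
    + replace (exp (- (PI * Im (w + 2 * tau * INR (S n)))))
        with (exp (- (PI * Im (w + 2 * tau * INR n))) * r)%R.
      * rewrite IH. simpl. ring.
      * unfold r. rewrite <- exp_plus. f_equal. rewrite S_INR. unfold Im. simpl. ring.
  - apply summable_scal, summable_geom. unfold r. split; [left; apply exp_pos|].
    rewrite <- exp_0. apply exp_increasing. nra.
Qed.

Lemma poch_tends (w tau : C) :
  (0 < Im tau)%R -> Ctends (Cprod (fun n => 1 - epi (w + 2 * tau * INR n))) (poch w tau).
Proof.
  intros Ht.
  destruct (Cprod_converges (fun n => - (1) * epi (w + 2 * tau * INR n))) as [l Hl].
  { apply summable_scal, summable_epi_nat; auto. }
  assert (H : Ctends (Cprod (fun n => 1 - epi (w + 2 * tau * INR n))) l).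
  { eapply Ctends_ext; [|apply Hl]. intros n. apply Cprod_ext. intros k. ring. }
  unfold poch. rewrite (Ctends_lim _ _ H). auto.
Qed.

Lemma epi_neq_1 (u : C) : Im u <> 0%R -> epi u <> 1.
Proof.
  intros H E. pose proof (Cmod_epi u) as Hm. rewrite E, Cmod_1 in Hm.
  rewrite <- exp_0 in Hm. apply exp_inv in Hm. pose proof PI_RGT_0.
  apply H. apply Rmult_eq_reg_l with PI; lra.
Qed.

Lemma one_minus_epi_neq_0 (u : C) : Im u <> 0%R -> 1 - epi u <> 0.
Proof.
  intros H E. apply (epi_neq_1 u H). replace (epi u) with (1 - (1 - epi u)) by ring.
  rewrite E. ring.
Qed.

Section JacobiTriple.
Context (tau : C) (Ht : (0 < Im tau)%R).

(** The finite product (q; q)_N, with q = [epi (2 * tau)]. *)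
Definition qfac (N : nat) : C := Cprod (fun n => 1 - epi (2 * tau + 2 * tau * INR n)) N.

Lemma qfac_factor_neq_0 n : 1 - epi (2 * tau + 2 * tau * INR n) <> 0.
Proof.
  apply one_minus_epi_neq_0. pose proof (pos_INR n).
  replace (Im _) with (2 * Im tau * (1 + INR n))%R by (unfold Im; simpl; ring).
  apply Rgt_not_eq. apply Rmult_lt_0_compat; lra.
Qed.

Lemma qfac_neq_0 N : qfac N <> 0.
Proof.
  induction N as [|N IH]; unfold qfac; simpl; [apply C1_nz|].
  apply Cmult_neq_0; auto. apply qfac_factor_neq_0.
Qed.

Lemma qfac_bounded : exists M, (0 < M)%R /\ forall N, (Cmod (qfac N) <= M)%R.
Proof.
  destruct (Cprod_bounded (fun n => - (1) * epi (2 * tau + 2 * tau * INR n))) as (M & HM & H).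
  { apply summable_scal, summable_epi_nat; auto. }
  exists M. split; auto. intros N. eapply Rle_trans; [|apply (H N)].
  right. f_equal. apply Cprod_ext. intros k. ring.
Qed.

(** Since 1 / (1 - q^{n+1}) = 1 + [inv_term n], the reciprocals of [qfac] are again partial products
    over a summable family: they are bounded and converge. *)
Let inv_term (n : nat) : C :=
  epi (2 * tau + 2 * tau * INR n) / (1 - epi (2 * tau + 2 * tau * INR n)).

Lemma inv_term_summable : summable inv_term.
Proof.
  pose (r := exp (- (2 * PI * Im tau))).
  assert (Hr : (r < 1)%R).
  { unfold r. rewrite <- exp_0. apply exp_increasing. pose proof PI_RGT_0. nra. }
  apply summable_le with (fun n => RtoC (/ (1 - r)) * epi (2 * tau + 2 * tau * INR n)).
  - intros n. unfold inv_term. pose proof (qfac_factor_neq_0 n) as Hn.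
    unfold Cdiv. rewrite !Cmod_mult, Rmult_comm. apply Rmult_le_compat_r; [apply Cmod_ge_0|].
    rewrite Cmod_R, Cmod_inv by auto.
    rewrite Rabs_pos_eq by (left; apply Rinv_0_lt_compat; lra).
    apply Rinv_le_contravar; [lra|].
    assert (Cmod (epi (2 * tau + 2 * tau * INR n)) <= r)%R.
    { rewrite Cmod_epi. unfold r. apply exp_le_compat.
      replace (Im (2 * tau + 2 * tau * INR n)) with (2 * Im tau * (1 + INR n))%R
        by (unfold Im; simpl; ring).
      pose proof (pos_INR n). pose proof PI_RGT_0.
      assert (0 <= PI * (Im tau * INR n))%R.
      { apply Rmult_le_pos; [lra|]. apply Rmult_le_pos; [|auto]. left; auto. }
      lra. }
    pose proof (Cmod_triangle (1 - epi (2 * tau + 2 * tau * INR n))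
                  (epi (2 * tau + 2 * tau * INR n))) as Htri.
    replace (1 - epi (2 * tau + 2 * tau * INR n) + epi (2 * tau + 2 * tau * INR n))
      with (RtoC 1) in Htri by ring.
    rewrite Cmod_1 in Htri. lra.
  - apply summable_scal, summable_epi_nat; auto.
Qed.

Lemma qfac_inv N : / qfac N = Cprod (fun n => 1 + inv_term n) N.
Proof.
  induction N as [|N IH]; unfold qfac; simpl; [field|].
  rewrite <- IH. unfold inv_term, qfac.
  pose proof (qfac_factor_neq_0 N). pose proof (qfac_neq_0 N). unfold qfac in *.
  field. auto.
Qed.

Lemma qfac_inv_bounded : exists M, (0 < M)%R /\ forall N, (Cmod (/ qfac N) <= M)%R.
Proof.
  destruct (Cprod_bounded inv_term inv_term_summable) as (M & HM & H).
  exists M. split; auto. intros N. rewrite qfac_inv. auto.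
Qed.

Definition qinf : C := poch (2 * tau) tau.

Lemma qfac_tends : Ctends qfac qinf.
Proof. apply poch_tends; auto. Qed.

(** The reciprocals of the partial products converge too, and their limit is an inverse of
    [qinf]. *)
Lemma qinf_neq_0 : qinf <> 0.
Proof.
  destruct (Cprod_converges inv_term inv_term_summable) as [l Hl].
  assert (H : qinf * l = 1).
  { eapply Ctends_unique; [apply (Ctends_mult _ _ _ _ qfac_tends Hl)|].
    eapply Ctends_ext; [|apply (Ctends_const 1)].
    intros n. simpl. rewrite <- qfac_inv. pose proof (qfac_neq_0 n). field. auto. }
  intros E. rewrite E in H. rewrite Cmult_0_l in H. symmetry in H. apply C1_nz; auto.
Qed.

Lemma qfac_inv_tends : Ctends (fun N => / qfac N) (/ qinf).
Proof.
  destruct (Cprod_converges inv_term inv_term_summable) as [l Hl].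
  assert (H : qinf * l = 1).
  { eapply Ctends_unique; [apply (Ctends_mult _ _ _ _ qfac_tends Hl)|].
    eapply Ctends_ext; [|apply (Ctends_const 1)].
    intros n. simpl. rewrite <- qfac_inv. pose proof (qfac_neq_0 n). field. auto. }
  replace (/ qinf) with l.
  - eapply Ctends_ext; [|apply Hl]. intros n. symmetry. apply qfac_inv.
  - pose proof qinf_neq_0. replace l with (qinf * l / qinf) by (field; auto).
    rewrite H. field. auto.
Qed.

(** 1 / (q; q)_m, extended by 0 to negative m. *)
Definition rfac (m : Z) : C := if Z.leb 0 m then / qfac (Z.to_nat m) else 0.

(** At m = 0 the factor 1 - q^m vanishes, which agrees with the value 0 of [rfac] at -1; hence the
    recurrence holds on all integers. *)
Lemma rfac_pred (m : Z) : rfac (m - 1) = (1 - epi (2 * tau * IZR m)) * rfac m.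
Proof.
  unfold rfac. destruct (Z.leb_spec 0 (m - 1)), (Z.leb_spec 0 m); try lia.
  - replace (Z.to_nat m) with (S (Z.to_nat (m - 1))) by lia.
    pose proof (qfac_factor_neq_0 (Z.to_nat (m - 1))) as H1.
    pose proof (qfac_neq_0 (Z.to_nat (m - 1))) as H2.
    unfold qfac in *. simpl.
    replace (2 * tau * IZR m) with (2 * tau + 2 * tau * INR (Z.to_nat (m - 1))).
    + field. auto.
    + rewrite INR_IZR_INZ, Z2Nat.id by lia. cring.
  - replace m with 0%Z by lia. rewrite Cmult_0_r, epi_0. ring.
  - ring.
Qed.

Lemma rfac_tends (n : Z) : Ctends (fun N => rfac (Z.of_nat N + n)) (/ qinf).
Proof.
  intros eps He. destruct (qfac_inv_tends eps He) as [K HK].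
  exists (K + Z.abs_nat n)%nat. intros N HN. unfold rfac.
  destruct (Z.leb_spec 0 (Z.of_nat N + n)); [|lia]. apply HK. lia.
Qed.

(** This is (-1)^n q^{n(n-1)/2}, the coefficient of y^n in (q; q) (y; q) (q / y; q). *)
Definition sgauss (n : Z) : C := epi (IZR n + tau * IZR n * (IZR n - 1)).

(** [sgauss n] times the Gaussian binomial coefficient of 2 N over N + n, which is 0 for |n| > N. *)
Definition jcoef (N : nat) (n : Z) : C :=
  sgauss n * qfac (2 * N) * rfac (Z.of_nat N + n) * rfac (Z.of_nat N - n).

(** The coefficient form of multiplication by (1 - Q y) (1 - Q q / y) = 1 + Q^2 q - Q y - Q q / y,
    with Q = q^N. After division by [sgauss n], [qfac (2 * N)], [u] and [v] it is a rational
    identity in Q, q and X = q^n. *)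
Lemma jcoef_succ N n :
  jcoef (S N) n =
    (1 + epi (2 * tau * INR N) ^ 2 * epi (2 * tau)) * jcoef N n
    - epi (2 * tau * INR N) * jcoef N (n - 1)
    - epi (2 * tau * INR N) * epi (2 * tau) * jcoef N (n + 1).
Proof.
  unfold jcoef.
  set (Q := epi (2 * tau * INR N)). set (q := epi (2 * tau)).
  set (X := epi (2 * tau * IZR n)).
  assert (HX : X <> 0) by apply epi_neq_0.
  set (u := rfac (Z.of_nat (S N) + n)). set (v := rfac (Z.of_nat (S N) - n)).
  assert (E1 : sgauss (n - 1) = - (q / X) * sgauss n).
  { replace (- (q / X) * sgauss n) with (- (q * / X * sgauss n)) by (unfold Cdiv; ring).
    unfold sgauss, q, X. rewrite <- epi_opp, <- !epi_plus.
    apply (epi_neg _ _ (-1)). cring. }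
  assert (E2 : sgauss (n + 1) = - X * sgauss n).
  { unfold sgauss, X. replace (- epi _ * _) with
      (- (epi (2 * tau * IZR n) * epi (IZR n + tau * IZR n * (IZR n - 1)))) by ring.
    rewrite <- epi_plus. apply (epi_neg _ _ 0). cring. }
  assert (HI : RtoC (INR N) = RtoC (IZR (Z.of_nat N))) by (rewrite INR_IZR_INZ; auto).
  assert (F1 : rfac (Z.of_nat N + n) = (1 - Q * q * X) * u).
  { unfold u, Q, q, X. rewrite <- !epi_plus, HI.
    replace (Z.of_nat N + n)%Z with (Z.of_nat (S N) + n - 1)%Z by lia. rewrite rfac_pred.
    do 3 f_equal. rewrite Nat2Z.inj_succ, <- Z.add_1_r. cring. }
  assert (F2 : rfac (Z.of_nat N - n) = (1 - Q * q / X) * v).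
  { unfold v, Q, q, X, Cdiv. rewrite <- epi_opp, <- !epi_plus, HI.
    replace (Z.of_nat N - n)%Z with (Z.of_nat (S N) - n - 1)%Z by lia. rewrite rfac_pred.
    do 3 f_equal. rewrite Nat2Z.inj_succ, <- Z.add_1_r. cring. }
  assert (F3 : rfac (Z.of_nat N + (n - 1)) = (1 - Q * X) * (1 - Q * q * X) * u).
  { replace (Z.of_nat N + (n - 1))%Z with (Z.of_nat N + n - 1)%Z by lia.
    rewrite rfac_pred, F1, Cmult_assoc. do 2 f_equal.
    unfold Q, X. rewrite <- epi_plus, HI. do 2 f_equal. cring. }
  assert (F4 : rfac (Z.of_nat N - (n + 1)) = (1 - Q / X) * (1 - Q * q / X) * v).
  { replace (Z.of_nat N - (n + 1))%Z with (Z.of_nat N - n - 1)%Z by lia.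
    rewrite rfac_pred, F2, Cmult_assoc. do 2 f_equal.
    unfold Q, X, Cdiv. rewrite <- epi_opp, <- epi_plus, HI. do 2 f_equal. cring. }
  replace (Z.of_nat N - (n - 1))%Z with (Z.of_nat (S N) - n)%Z by lia.
  replace (Z.of_nat N + (n + 1))%Z with (Z.of_nat (S N) + n)%Z by lia.
  fold u v.
  assert (F5 : qfac (2 * S N) = qfac (2 * N) * (1 - Q ^ 2 * q) * (1 - Q ^ 2 * q ^ 2)).
  { replace (2 * S N)%nat with (S (S (2 * N))) by lia. unfold qfac. cbn [Cprod].
    replace (Q ^ 2 * q) with (Q * Q * q) by ring.
    replace (Q ^ 2 * q ^ 2) with (Q * Q * q * q) by ring.
    unfold Q, q. rewrite <- !epi_plus. f_equal.
    - f_equal. do 2 f_equal. rewrite mult_INR, RtoC_mult. simpl. cring.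
    - do 2 f_equal. rewrite S_INR, mult_INR, RtoC_plus, RtoC_mult. simpl. cring. }
  rewrite F1, F2, F3, F4, F5, E1, E2. field. auto.
Qed.

Lemma jcoef_0 n : jcoef 0 n = if Z.eqb n 0 then 1 else 0.
Proof.
  unfold jcoef, rfac, sgauss. cbn [Z.of_nat].
  destruct (Z.eqb_spec n 0) as [->|Hn].
  - simpl. unfold qfac. simpl. rewrite Cmult_0_r, Cmult_0_l, Cplus_0_r, epi_0. field.
  - destruct (Z.leb_spec 0 (0 + n)), (Z.leb_spec 0 (0 - n)); try lia; ring.
Qed.

(** The next two factors shift the powers of y = [epi w] by at most one, which is the recurrence
    [jcoef_succ]. *)
Lemma jacobi_finite (w : C) (N : nat) :
  has_sum (fun n => jcoef N n * epi (IZR n * w))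
    (Cprod (fun n => 1 - epi (w + 2 * tau * INR n)) N
     * Cprod (fun n => 1 - epi (2 * tau - w + 2 * tau * INR n)) N).
Proof.
  induction N as [|N IH].
  - replace (_ * _) with (jcoef 0 0 * epi (IZR 0 * w)).
    + apply (has_sum_single (fun n => jcoef 0 n * epi (IZR n * w))).
      intros n Hn. rewrite jcoef_0. destruct (Z.eqb_spec n 0); [contradiction|ring].
    + rewrite jcoef_0. simpl. rewrite Cmult_0_l, epi_0. ring.
  - cbn [Cprod].
    set (P := Cprod _ N * Cprod _ N) in IH.
    set (Q := epi (2 * tau * INR N)). set (q := epi (2 * tau)). set (Y := epi w).
    assert (HY : Y <> 0) by apply epi_neq_0.
    assert (H1 : has_sum (fun n => jcoef N (n - 1) * epi (IZR n * w)) (Y * P)).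
    { pose proof (has_sum_reindex (fun n : Z => n - 1)%Z (fun n : Z => n + 1)%Z _ _
        ltac:(intros; cbv beta; lia) ltac:(intros; cbv beta; lia) (has_sum_scal Y _ _ IH)) as H.
      eapply has_sum_ext; [|apply H]. intros n. cbv beta.
      replace (epi (IZR n * w)) with (Y * epi (IZR (n - 1) * w)).
      - ring.
      - unfold Y. rewrite <- epi_plus. f_equal. cring. }
    assert (H2 : has_sum (fun n => jcoef N (n + 1) * epi (IZR n * w)) (/ Y * P)).
    { pose proof (has_sum_reindex (fun n : Z => n + 1)%Z (fun n : Z => n - 1)%Z _ _
        ltac:(intros; cbv beta; lia) ltac:(intros; cbv beta; lia) (has_sum_scal (/ Y) _ _ IH)) as H.
      eapply has_sum_ext; [|apply H]. intros n. cbv beta.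
      replace (epi (IZR n * w)) with (/ Y * epi (IZR (n + 1) * w)).
      - ring.
      - unfold Y. rewrite <- epi_opp, <- epi_plus. f_equal. cring. }
    pose proof (has_sum_minus _ _ _ _
      (has_sum_minus _ _ _ _ (has_sum_scal (1 + Q ^ 2 * q) _ _ IH) (has_sum_scal Q _ _ H1))
      (has_sum_scal (Q * q) _ _ H2)) as H.
    replace (_ * _ * (_ * _)) with
      ((1 + Q ^ 2 * q) * P - Q * (Y * P) - Q * q * (/ Y * P)).
    + eapply has_sum_ext; [|apply H]. intros n. cbv beta. rewrite jcoef_succ.
      fold Q q. ring.
    + replace (epi (w + 2 * tau * INR N)) with (Y * Q)
        by (unfold Y, Q; rewrite <- epi_plus; f_equal; ring).
      replace (epi (2 * tau - w + 2 * tau * INR N)) with (Q * q / Y)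
        by (unfold Y, Q, q, Cdiv; rewrite <- epi_opp, <- !epi_plus; f_equal; ring).
      unfold P. field. auto.
Qed.

(** At y = 1 the finite product and its derivative y d/dy satisfy a recurrence in N of their own, so
    Jacobi's cube is reached without differentiating an infinite product. *)
Lemma jacobi_finite_moment (N : nat) :
  has_sum (jcoef (S N)) 0 /\
  has_sum (fun n => IZR n * jcoef (S N) n) (- (qfac N * qfac (S N))).
Proof.
  assert (Hstep : forall N P D, has_sum (jcoef N) P -> has_sum (fun n => IZR n * jcoef N n) D ->
    let Q := epi (2 * tau * INR N) in let q := epi (2 * tau) in
    has_sum (jcoef (S N)) ((1 - Q) * (1 - Q * q) * P) /\
    has_sum (fun n => IZR n * jcoef (S N) n) ((1 - Q) * (1 - Q * q) * D - Q * (1 - q) * P)).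
  { clear N. intros N P D HP HD Q q.
    assert (H1 : has_sum (fun n => jcoef N (n - 1)) P).
    { apply (has_sum_reindex (fun n : Z => n - 1)%Z (fun n : Z => n + 1)%Z); auto;
      intros; lia. }
    assert (H2 : has_sum (fun n => jcoef N (n + 1)) P).
    { apply (has_sum_reindex (fun n : Z => n + 1)%Z (fun n : Z => n - 1)%Z); auto;
      intros; lia. }
    assert (G1 : has_sum (fun n => IZR n * jcoef N (n - 1)) (D + P)).
    { pose proof (has_sum_plus _ _ _ _ HD HP) as H.
      apply (has_sum_reindex (fun n : Z => n - 1)%Z (fun n : Z => n + 1)%Z) in H;
      try (intros; lia).
      eapply has_sum_ext; [|apply H]. intros n. cbv beta. cast. ring. }
    assert (G2 : has_sum (fun n => IZR n * jcoef N (n + 1)) (D - P)).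
    { pose proof (has_sum_minus _ _ _ _ HD HP) as H.
      apply (has_sum_reindex (fun n : Z => n + 1)%Z (fun n : Z => n - 1)%Z) in H;
      try (intros; lia).
      eapply has_sum_ext; [|apply H]. intros n. cbv beta. cast. ring. }
    split.
    - replace (_ * P) with ((1 + Q ^ 2 * q) * P - Q * P - Q * q * P) by ring.
      eapply has_sum_ext; [|apply (has_sum_minus _ _ _ _
        (has_sum_minus _ _ _ _ (has_sum_scal (1 + Q ^ 2 * q) _ _ HP) (has_sum_scal Q _ _ H1))
        (has_sum_scal (Q * q) _ _ H2))].
      intros n. cbv beta. rewrite jcoef_succ. reflexivity.
    - replace (_ - _) with ((1 + Q ^ 2 * q) * D - Q * (D + P) - Q * q * (D - P)) by ring.
      eapply has_sum_ext; [|apply (has_sum_minus _ _ _ _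
        (has_sum_minus _ _ _ _ (has_sum_scal (1 + Q ^ 2 * q) _ _ HD) (has_sum_scal Q _ _ G1))
        (has_sum_scal (Q * q) _ _ G2))].
      intros n. cbv beta. rewrite jcoef_succ. fold Q q. ring. }
  induction N as [|N [IH1 IH2]].
  (* The empty product has value 1 and moment 0. Here Q = 1, so the factor 1 - Q annihilates the
     value. *)
  - destruct (Hstep 0%nat 1 0) as [H1 H2].
    + replace (RtoC 1) with (jcoef 0 0) by (rewrite jcoef_0; auto).
      apply has_sum_single. intros n Hn. rewrite jcoef_0.
      destruct (Z.eqb_spec n 0); [contradiction|auto].
    + replace (RtoC 0) with (IZR 0 * jcoef 0 0) by (simpl; ring).
      apply (has_sum_single (fun n => IZR n * jcoef 0 n)). intros n Hn. rewrite jcoef_0.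
      destruct (Z.eqb_spec n 0); [contradiction|ring].
    + simpl INR in H1, H2. rewrite (Cmult_0_r (2 * tau)), epi_0 in H1, H2. split.
      * replace (RtoC 0) with ((1 - 1) * (1 - 1 * epi (2 * tau)) * 1) by ring. exact H1.
      * replace (- (qfac 0 * qfac 1)) with ((1 - 1) * (1 - 1 * epi (2 * tau)) * 0 -
                                            1 * (1 - epi (2 * tau)) * 1); [exact H2|].
        unfold qfac. simpl. rewrite (Cmult_0_r (2 * tau)), Cplus_0_r. ring.
  - destruct (Hstep (S N) _ _ IH1 IH2) as [H1 H2]. split.
    + rewrite Cmult_0_r in H1. exact H1.
    + eapply eq_ind; [exact H2|].
      unfold qfac. cbn [Cprod]. rewrite <- epi_plus.
      replace (2 * tau * INR (S N)) with (2 * tau + 2 * tau * INR N)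
        by (rewrite S_INR, RtoC_plus; ring).
      rewrite (Cplus_comm (2 * tau + 2 * tau * INR N) (2 * tau)). ring.
Qed.

Lemma jcoef_tends n : Ctends (fun N => jcoef N n) (sgauss n / qinf).
Proof.
  pose proof qinf_neq_0.
  replace (sgauss n / qinf) with (sgauss n * qinf * / qinf * / qinf) by (field; auto).
  unfold jcoef. repeat apply Ctends_mult.
  - apply Ctends_const.
  - apply (Ctends_sub qfac qinf (fun N => 2 * N)%nat); [|apply qfac_tends].
    intros; lia.
  - apply rfac_tends.
  - apply (rfac_tends (- n)).
Qed.

(** The Gaussian binomials are bounded uniformly in N and n; this is the domination under which N
    tends to infinity. *)
Lemma jcoef_bound : exists M, (0 < M)%R /\ forall N n, (Cmod (jcoef N n) <= M * Cmod (sgauss n))%R.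
Proof.
  destruct qfac_bounded as (M & HM & H). destruct qfac_inv_bounded as (M' & HM' & H').
  assert (Hr : forall m, (Cmod (rfac m) <= M')%R).
  { intros m. unfold rfac. destruct (Z.leb 0 m); auto. rewrite Cmod_0. lra. }
  exists (M * M' * M')%R. split; [repeat apply Rmult_lt_0_compat; auto|].
  intros N n. unfold jcoef. rewrite !Cmod_mult.
  replace (M * M' * M' * Cmod (sgauss n))%R with (Cmod (sgauss n) * M * M' * M')%R by ring.
  repeat apply Rmult_le_compat; auto; repeat apply Rmult_le_pos; try apply Cmod_ge_0; lra.
Qed.

Lemma summable_jacobi (w : C) : summable (fun n => sgauss n * epi (IZR n * w)).
Proof.
  eapply summable_ext; [intros n; apply epi_plus|].
  apply (summable_epi _ (Im tau) (Im w - Im tau) 0); auto.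
  intros n. unfold Im. simpl. ring.
Qed.

Lemma summable_jacobi_moment : summable (fun n => IZR n * sgauss n).
Proof.
  apply (summable_gauss1 _ (PI * Im tau) (PI * Rabs (- Im tau) + 1) (- (PI * 0))).
  - apply Rmult_lt_0_compat; auto. apply PI_RGT_0.
  - intros n. rewrite Cmod_mult, Cmod_R. unfold sgauss. rewrite Cmod_epi.
    replace (Im _) with (Im tau * IZR n ^ 2 + - Im tau * IZR n + 0)%R
      by (unfold Im; simpl; ring).
    apply Rle_trans with
      (exp (Rabs (IZR n)) * gauss (PI * Im tau) (PI * Rabs (- Im tau)) (- (PI * 0)) n)%R.
    + apply Rmult_le_compat; [apply Rabs_pos|left; apply exp_pos| |apply gauss_bound].
      pose proof (exp_ineq1_le (Rabs (IZR n))). lra.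
    + unfold gauss. rewrite <- exp_plus. right. f_equal. ring.
Qed.

(** The limit of [jacobi_finite], whose coefficients tend to [sgauss n / qinf]; the factor [qinf] on
    the product side comes from there. *)
Lemma jacobi_triple (w : C) :
  has_sum (fun n => sgauss n * epi (IZR n * w)) (qinf * poch w tau * poch (2 * tau - w) tau).
Proof.
  destruct jcoef_bound as (M & HM & Hb).
  destruct (summable_has_sum _ (summable_jacobi w)) as [s Hs].
  pose proof qinf_neq_0 as Hq.
  assert (H : Ctends (fun N => Cprod (fun n => 1 - epi (w + 2 * tau * INR n)) N
     * Cprod (fun n => 1 - epi (2 * tau - w + 2 * tau * INR n)) N) (/ qinf * s)).
  { apply (has_sum_dominated_convergence (fun N n => jcoef N n * epi (IZR n * w))
             (fun n => RtoC M * (sgauss n * epi (IZR n * w)))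
             (fun n => / qinf * (sgauss n * epi (IZR n * w)))).
    - apply summable_scal, summable_jacobi.
    - intros N n. rewrite !Cmod_mult, Cmod_R, (Rabs_pos_eq M), <- Rmult_assoc by lra.
      apply Rmult_le_compat_r; [apply Cmod_ge_0|auto].
    - intros n. replace (/ qinf * _) with (sgauss n / qinf * epi (IZR n * w)) by (field; auto).
      apply Ctends_mult; [apply jcoef_tends|apply Ctends_const].
    - intros N. apply jacobi_finite.
    - apply has_sum_scal; auto. }
  assert (E : / qinf * s = poch w tau * poch (2 * tau - w) tau).
  { eapply Ctends_unique; [apply H|]. apply Ctends_mult; apply poch_tends; auto. }
  replace (qinf * poch w tau * poch (2 * tau - w) tau) with s; auto.
  rewrite <- Cmult_assoc, <- E. field. auto.
Qed.

(** The same passage to the limit, starting from the moments - (q; q)_N (q; q)_{N+1}. *)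
Lemma jacobi_cube : has_sum (fun n => IZR n * sgauss n) (- qinf ^ 3).
Proof.
  destruct jcoef_bound as (M & HM & Hb).
  destruct (summable_has_sum _ summable_jacobi_moment) as [s Hs].
  pose proof qinf_neq_0 as Hq.
  assert (H : Ctends (fun N => - (1) * (qfac N * qfac (S N))) (/ qinf * s)).
  { apply (has_sum_dominated_convergence (fun N n => IZR n * jcoef (S N) n)
             (fun n => RtoC M * (IZR n * sgauss n))
             (fun n => / qinf * (IZR n * sgauss n))).
    - apply summable_scal, summable_jacobi_moment.
    - intros N n. rewrite !Cmod_mult, (Cmod_R M), (Rabs_pos_eq M) by lra.
      rewrite <- Rmult_assoc, (Rmult_comm M), Rmult_assoc.
      apply Rmult_le_compat_l; [apply Cmod_ge_0|auto].
    - intros n. replace (/ qinf * _) with (IZR n * (sgauss n / qinf)) by (field; auto).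
      apply Ctends_mult; [apply Ctends_const|].
      apply (Ctends_sub (fun N => jcoef N n) _ S); [|apply jcoef_tends].
      intros; lia.
    - intros N. replace (- (1) * _) with (- (qfac N * qfac (S N))) by ring.
      apply jacobi_finite_moment.
    - apply has_sum_scal; auto. }
  assert (E : / qinf * s = - (1) * (qinf * qinf)).
  { eapply Ctends_unique; [apply H|]. apply Ctends_mult; [apply Ctends_const|].
    apply Ctends_mult; [apply qfac_tends|].
    apply (Ctends_sub qfac qinf S); [|apply qfac_tends].
    intros; lia. }
  replace (- qinf ^ 3) with s; auto.
  replace s with (qinf * (/ qinf * s)) by (field; auto). rewrite E. simpl. ring.
Qed.

End JacobiTriple.

(** * Theta constants as eta quotients *)

Lemma poch_ext (w w' tau : C) : epi w = epi w' -> poch w tau = poch w' tau.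
Proof.
  intros H. unfold poch, CLim_seq. f_equal; f_equal; apply Lim_seq_ext; intros n;
  f_equal; apply Cprod_ext; intros k; rewrite !epi_plus, H; reflexivity.
Qed.

Lemma Im_double (tau : C) : (0 < Im tau)%R -> (0 < Im (2 * tau))%R.
Proof. intros H. unfold Im in *. simpl. lra. Qed.

(** Separates even and odd powers of q: (a; q) = (a; q^2) (a q; q^2). *)
Lemma poch_split (w tau : C) : (0 < Im tau)%R ->
  poch w tau = poch w (2 * tau) * poch (w + 2 * tau) (2 * tau).
Proof.
  intros Ht. pose proof (Im_double tau Ht) as Ht2.
  eapply Ctends_unique; [|apply Ctends_mult; apply poch_tends; auto].
  eapply Ctends_ext; [|apply (Ctends_sub _ _ (fun N => 2 * N)%nat ltac:(intros; cbv beta; lia) (poch_tends w tau Ht))].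
  - intros N. induction N as [|N IH]; [simpl; ring|].
    replace (2 * S N)%nat with (S (S (2 * N))) by lia. cbn [Cprod]. cbv beta in *. rewrite IH.
    rewrite S_INR, !mult_INR, !RtoC_plus, !RtoC_mult. replace (INR 2) with 2%R by (simpl; ring).
    replace (w + 2 * tau * (RtoC 2 * INR N)) with (w + 2 * (2 * tau) * INR N) by ring.
    replace (w + 2 * tau * (RtoC 2 * INR N + 1))
      with (w + 2 * tau + 2 * (2 * tau) * INR N) by ring. ring.
Qed.

(** Factor by factor, (1 - a) (1 + a) = 1 - a^2. *)
Lemma poch_neg (w tau : C) : (0 < Im tau)%R ->
  poch w tau * poch (w + 1) tau = poch (2 * w) (2 * tau).
Proof.
  intros Ht. pose proof (Im_double tau Ht) as Ht2.
  eapply Ctends_unique; [apply Ctends_mult; apply poch_tends; auto|].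
  eapply Ctends_ext; [|apply (poch_tends (2 * w) (2 * tau) Ht2)].
  intros N. simpl. rewrite <- Cprod_mult. apply Cprod_ext. intros n.
  replace (w + 1 + 2 * tau * INR n) with (w + 2 * tau * INR n + 1) by ring.
  rewrite epi_add_1.
  replace (2 * w + 2 * (2 * tau) * INR n)
    with ((w + 2 * tau * INR n) + (w + 2 * tau * INR n)) by ring.
  rewrite epi_plus. ring.
Qed.

Lemma poch_step (w tau : C) : (0 < Im tau)%R ->
  poch w tau = (1 - epi w) * poch (w + 2 * tau) tau.
Proof.
  intros Ht.
  eapply Ctends_unique; [|apply Ctends_mult; [apply Ctends_const|apply poch_tends; auto]].
  eapply Ctends_ext; [|apply (Ctends_sub _ _ S ltac:(intros; cbv beta; lia) (poch_tends w tau Ht))].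
  - intros N. cbv beta. induction N as [|N IH].
    + simpl. rewrite Cmult_0_r, Cplus_0_r. ring.
    + cbn [Cprod] in *. rewrite IH.
      replace (w + 2 * tau * INR (S N)) with (w + 2 * tau + 2 * tau * INR N)
        by (rewrite S_INR, RtoC_plus; ring). ring.
Qed.

Lemma eta_qinf (tau : C) : eta tau = epi (tau / 12) * qinf tau.
Proof.
  unfold eta, qpow, qinf, poch. f_equal.
  - unfold epi. f_equal. rewrite RtoC_div by lra. field.
  - unfold CLim_seq. f_equal; f_equal; apply Lim_seq_ext; intros n; f_equal;
    apply Cprod_ext; intros k; unfold epi; do 2 f_equal; rewrite S_INR, RtoC_plus; ring.
Qed.

Lemma eta_neq_0 (tau : C) : (0 < Im tau)%R -> eta tau <> 0.
Proof.
  intros Ht. rewrite eta_qinf. apply Cmult_neq_0; [apply epi_neq_0|apply qinf_neq_0; auto].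
Qed.

Definition theta_term (a b : nat) (tau z : C) (n : Z) : C :=
  epi (tau * (IZR n + INR a / 2) ^ 2 + 2 * (IZR n + INR a / 2) * (z + INR b / 2)).

Lemma summable_theta (a b : nat) (tau z : C) :
  (0 < Im tau)%R -> summable (theta_term a b tau z).
Proof.
  intros Ht. apply (summable_epi _ (Im tau) (Im tau * INR a + 2 * Im z)
    (Im tau * (INR a / 2) ^ 2 + INR a * Im z)); auto.
  intros n. unfold Im. simpl. field.
Qed.

Lemma theta_has_sum (a b : nat) (tau z : C) :
  (0 < Im tau)%R -> has_sum (theta_term a b tau z) (theta a b tau z).
Proof.
  intros Ht. pose proof (summable_theta a b tau z Ht) as S.
  destruct (summable_has_sum _ S) as [s Hs].
  replace (theta a b tau z) with s; auto.
  rewrite <- (has_sum_CSeriesZ _ _ S Hs). unfold theta, CSeriesZ. f_equal;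
  unfold CSeries; f_equal; apply Series_ext; intros n; unfold theta_term, epi; do 2 f_equal; ring.
Qed.

Lemma theta_eq (a b : nat) (tau z : C) (f : Z -> C) (s : C) : (0 < Im tau)%R ->
  has_sum f s -> (forall n, theta_term a b tau z n = f n) -> theta a b tau z = s.
Proof.
  intros Ht Hs H. apply (has_sum_unique f); auto.
  eapply has_sum_ext; [apply H|]. apply theta_has_sum; auto.
Qed.

Section ThetaConstants.
Context (tau : C) (Ht : (0 < Im tau)%R).
Let Ht2 : (0 < Im (2 * tau))%R := Im_double tau Ht.
Let Ht4 : (0 < Im (2 * (2 * tau)))%R := Im_double _ Ht2.

Lemma theta01_double_0 : theta 0 1 (2 * tau) 0 = qinf (2 * tau) * poch (2 * tau) (2 * tau) ^ 2.
Proof.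
  replace (_ * _ ^ 2) with
    (qinf (2 * tau) * poch (2 * tau) (2 * tau) * poch (2 * (2 * tau) - 2 * tau) (2 * tau)).
  - eapply theta_eq; [auto|apply jacobi_triple; auto|].
    intros n. unfold theta_term, sgauss. rewrite <- epi_plus. f_equal. simpl INR. field.
  - replace (2 * (2 * tau) - 2 * tau) with (2 * tau) by ring. ring.
Qed.

Lemma qinf_split : qinf tau = poch (2 * tau) (2 * tau) * qinf (2 * tau).
Proof.
  unfold qinf. rewrite (poch_split _ tau Ht). do 2 f_equal. ring.
Qed.

Lemma qinf_neg : qinf tau * poch (2 * tau + 1) tau = qinf (2 * tau).
Proof. unfold qinf. apply poch_neg; auto. Qed.

Lemma theta00_half_period :
  theta 0 0 tau (- tau / 2) = 2 * qinf tau * poch (2 * tau + 1) tau ^ 2.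
Proof.
  replace (2 * _ * _) with (qinf tau * poch 1 tau * poch (2 * tau - 1) tau).
  - eapply theta_eq; [auto|apply jacobi_triple; auto|].
    intros n. unfold theta_term, sgauss. rewrite <- epi_plus.
    apply (epi_eq _ _ (- n)). simpl INR. cring.
  - rewrite (poch_step 1 tau Ht), epi_1.
    rewrite (poch_ext (2 * tau - 1) (2 * tau + 1)) by (apply (epi_eq _ _ (-1)); ring).
    replace (1 + 2 * tau) with (2 * tau + 1) by ring. ring.
Qed.

(** Fixes the scalar at z = - tau / 2 and shows that it can be divided by. With a = (q; q^2) and b =
    (-q; q), [H1] and [H2] are Euler's a b = 1 in undivided form. *)
Lemma theta_constants_cube :
  theta 0 1 (2 * tau) 0 ^ 2 * theta 0 0 tau (- tau / 2) = 2 * qinf tau ^ 3.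
Proof.
  rewrite theta01_double_0, theta00_half_period.
  set (a := poch (2 * tau) (2 * tau)). set (b := poch (2 * tau + 1) tau).
  assert (H1 : qinf tau = a * qinf (2 * tau)) by apply qinf_split.
  assert (H2 : qinf tau * b = qinf (2 * tau)) by apply qinf_neg.
  replace ((qinf (2 * tau) * a ^ 2) ^ 2 * (2 * qinf tau * b ^ 2))
    with (2 * qinf tau * ((a * qinf (2 * tau)) * b * a) ^ 2) by ring.
  rewrite <- H1, H2, (Cmult_comm _ a), <- H1. ring.
Qed.

(** Eliminating a = (q; q^2) between (q; q) = a (q^2; q^2) and (q^2; q^2) = a d (q^4; q^4) expresses
    d = (-q; q^2) by eta products. The powers of q^{1/24} cancel: 5 * 2 = 2 * 1 + 2 * 4. *)
Lemma theta00_double_0 :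
  theta 0 0 (2 * tau) 0 = eta (2 * tau) ^ 5 / (eta tau ^ 2 * eta (4 * tau) ^ 2).
Proof.
  replace (4 * tau) with (2 * (2 * tau)) by ring.
  set (d := poch (2 * tau + 1) (2 * tau)). set (a := poch (2 * tau) (2 * tau)).
  assert (HA : theta 0 0 (2 * tau) 0 = qinf (2 * tau) * d ^ 2).
  { replace (_ * _ ^ 2) with
      (qinf (2 * tau) * d * poch (2 * (2 * tau) - (2 * tau + 1)) (2 * tau)).
    - eapply theta_eq; [auto|apply jacobi_triple; auto|].
      intros n. unfold theta_term, sgauss. rewrite <- epi_plus.
      apply (epi_eq _ _ (- n)). simpl INR. cring.
    - rewrite (poch_ext (2 * (2 * tau) - (2 * tau + 1)) (2 * tau + 1))
        by (apply (epi_eq _ _ (-1)); ring). fold d. ring. }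
  assert (H1 : qinf tau = a * qinf (2 * tau)) by apply qinf_split.
  assert (H2 : a * d = poch (2 * (2 * tau)) (2 * (2 * tau))) by (apply poch_neg; auto).
  assert (H3 : qinf (2 * tau) = a * d * qinf (2 * (2 * tau))).
  { rewrite H2. unfold qinf. rewrite (poch_split _ (2 * tau) Ht2). do 2 f_equal. ring. }
  pose proof (qinf_neq_0 tau Ht) as N1. pose proof (qinf_neq_0 _ Ht2) as N2.
  pose proof (qinf_neq_0 _ Ht4) as N4.
  rewrite HA, !eta_qinf.
  set (x := epi (tau / 12)).
  assert (E2 : epi (2 * tau / 12) = x ^ 2)
    by (unfold x; replace (2 * tau / 12) with (tau / 12 + tau / 12) by field;
        rewrite epi_plus; ring).
  assert (E4 : epi (2 * (2 * tau) / 12) = x ^ 4)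
    by (replace (2 * (2 * tau) / 12) with (2 * tau / 12 + 2 * tau / 12) by field;
        rewrite epi_plus, E2; ring).
  assert (Hx : x <> 0) by apply epi_neq_0.
  rewrite E2, E4.
  assert (Hd : d = qinf (2 * tau) ^ 2 / (qinf tau * qinf (2 * (2 * tau)))).
  { replace (qinf (2 * tau) ^ 2) with (qinf (2 * tau) * (a * d * qinf (2 * (2 * tau))))
      by (rewrite <- H3; ring).
    replace (qinf (2 * tau) * (a * d * qinf (2 * (2 * tau))))
      with (a * qinf (2 * tau) * d * qinf (2 * (2 * tau))) by ring.
    rewrite <- H1. field. auto. }
  rewrite Hd. field. auto.
Qed.

(** The factor q^{1/4} = [epi (tau / 2)] is what the fractional powers in the eta quotient leave: 2
    * 4/24 - 2/24. *)
Lemma theta10_double_0 :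
  theta 1 0 (2 * tau) 0 = 2 * (eta (4 * tau) ^ 2 / eta (2 * tau)).
Proof.
  replace (4 * tau) with (2 * (2 * tau)) by ring.
  set (g := poch (2 * (2 * tau) + 1) (2 * tau)).
  assert (HB : theta 1 0 (2 * tau) 0 = epi (tau / 2) * (2 * qinf (2 * tau) * g ^ 2)).
  { replace (2 * _ * _ ^ 2) with
      (qinf (2 * tau) * g * poch (2 * (2 * tau) - (2 * (2 * tau) + 1)) (2 * tau)).
    - eapply theta_eq; [auto|apply has_sum_scal, jacobi_triple; auto|].
      intros n. unfold theta_term, sgauss. rewrite <- !epi_plus.
      apply (epi_eq _ _ (- n)). simpl INR. cring.
    - rewrite (poch_ext (2 * (2 * tau) - (2 * (2 * tau) + 1)) 1)
        by (apply (epi_eq _ _ (-1)); ring).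
      rewrite (poch_step 1 _ Ht2), epi_1.
      replace (1 + 2 * (2 * tau)) with (2 * (2 * tau) + 1) by ring. fold g. ring. }
  assert (H : qinf (2 * tau) * g = qinf (2 * (2 * tau))) by (unfold qinf, g; apply poch_neg; auto).
  pose proof (qinf_neq_0 _ Ht2) as N2.
  rewrite HB, !eta_qinf.
  replace (epi (tau / 2)) with (epi (2 * (2 * tau) / 12) ^ 2 / epi (2 * tau / 12)).
  - pose proof (epi_neq_0 (2 * tau / 12)).
    replace g with (qinf (2 * (2 * tau)) / qinf (2 * tau)); [field; auto|].
    rewrite <- H. field. auto.
  - replace (_ ^ 2) with (epi (2 * (2 * tau) / 12) * epi (2 * (2 * tau) / 12)) by ring.
    unfold Cdiv at 1. rewrite <- epi_opp, <- !epi_plus. f_equal. field.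
Qed.

End ThetaConstants.

(** * Doubling formulas for theta functions *)

Lemma has_sum_shift (f : Z -> C) (s : C) (k : Z) :
  has_sum f s -> has_sum (fun n => f (n + k)%Z) s.
Proof.
  apply (has_sum_reindex (fun n : Z => n + k)%Z (fun n : Z => n - k)%Z); intros; lia.
Qed.

Lemma has_sum_antisym {I : Type} (phi : I -> I) (f : I -> C) (s : C) :
  (forall i, phi (phi i) = i) -> (forall i, f (phi i) = - f i) -> has_sum f s -> s = 0.
Proof.
  intros Hphi Hf Hs.
  assert (E : s = - s).
  { apply (has_sum_unique (fun i => f (phi i))).
    - apply (has_sum_reindex phi phi); auto.
    - eapply has_sum_ext; [intros i; symmetry; apply Hf|]. apply has_sum_opp; auto. }
  replace s with ((s - - s) / 2) by field. rewrite <- E. field.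
Qed.

Lemma theta11_0 (tau : C) : (0 < Im tau)%R -> theta 1 1 tau 0 = 0.
Proof.
  intros Ht.
  apply (has_sum_antisym (fun n => - 1 - n)%Z (theta_term 1 1 tau 0)).
  - intros; lia.
  - intros n. unfold theta_term. apply (epi_neg _ _ (-1 - n)). simpl INR. cring.
  - apply theta_has_sum; auto.
Qed.

(** The pairs (m, n) are split by the parity of m - n. Then m^2 + n^2 is 2 c^2 + 2 d^2 or 2 (c +
    1/2)^2 + 2 (d + 1/2)^2, so products of theta functions at tau become products at 2 tau. *)
Lemma has_sum_parity (f : Z * Z -> C) (s s0 s1 : C) :
  has_sum f s ->
  has_sum (fun p => f (fst p + snd p, fst p - snd p)%Z) s0 ->
  has_sum (fun p => f (fst p + snd p + 1, fst p - snd p)%Z) s1 ->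
  s = s0 + s1.
Proof.
  intros H H0 H1.
  pose (phi := fun p : bool * (Z * Z) => let (b, cd) := p in
    (fst cd + snd cd + (if b then 0 else 1), fst cd - snd cd)%Z).
  pose (psi := fun p : Z * Z => let t := (fst p - snd p)%Z in
    (Z.even t, (snd p + t / 2, t / 2)%Z)).
  apply (has_sum_unique (fun b : bool => if b then s0 else s1));
    [|apply (has_sum_bool (fun b : bool => if b then s0 else s1))].
  apply (has_sum_fubini (fun p => f (phi p))).
  - apply (has_sum_reindex phi psi); auto.
    + intros [b [c d]]. unfold phi, psi. cbn [fst snd].
      assert (Hd : ((c + d + (if b then 0 else 1) - (c - d)) / 2 = d)%Z).
      { symmetry. apply Z.div_unique with (if b then 0 else 1)%Z; destruct b; lia. }
      rewrite Hd. f_equal.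
      * replace (c + d + (if b then 0 else 1) - (c - d))%Z with
          ((if b then 0 else 1) + 2 * d)%Z by lia.
        rewrite Z.even_add_mul_2. destruct b; auto.
      * f_equal. lia.
    + intros [m n]. unfold phi, psi. cbn [fst snd].
      pose proof (Z.div_mod (m - n) 2 ltac:(lia)) as Hdm.
      rewrite Zmod_even in Hdm. destruct (Z.even (m - n)); f_equal; lia.
  - intros [|]; simpl; auto. eapply has_sum_ext; [|apply H0].
    intros [c d]. unfold phi. simpl. rewrite Z.add_0_r. auto.
Qed.

Section Bilinear.
Context (tau : C) (Ht : (0 < Im tau)%R).
Let Ht2 : (0 < Im (2 * tau))%R := Im_double tau Ht.

Lemma theta_mult_has_sum (a b a' b' : nat) (tau1 tau2 z1 z2 : C) :
  (0 < Im tau1)%R -> (0 < Im tau2)%R ->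
  has_sum (fun p => theta_term a b tau1 z1 (fst p) * theta_term a' b' tau2 z2 (snd p))
    (theta a b tau1 z1 * theta a' b' tau2 z2).
Proof.
  intros H1 H2. apply has_sum_prod; auto using summable_theta, theta_has_sum.
Qed.

Lemma theta00_sqr (z : C) :
  theta 0 0 tau z ^ 2 =
    theta 0 0 (2 * tau) 0 * theta 0 0 (2 * tau) (2 * z)
    + theta 1 0 (2 * tau) 0 * theta 1 0 (2 * tau) (2 * z).
Proof.
  replace (theta 0 0 tau z ^ 2) with (theta 0 0 tau z * theta 0 0 tau z) by ring.
  eapply has_sum_parity.
  - apply theta_mult_has_sum; auto.
  - rewrite Cmult_comm. eapply has_sum_ext; [|apply theta_mult_has_sum; auto].
    intros [c d]. unfold theta_term. cbn [fst snd]. rewrite <- !epi_plus.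
    f_equal. simpl INR. cring.
  - rewrite Cmult_comm. eapply has_sum_ext; [|apply theta_mult_has_sum; auto].
    intros [c d]. unfold theta_term. cbn [fst snd]. rewrite <- !epi_plus.
    f_equal. simpl INR. cring.
Qed.

Lemma theta00_theta01 (z : C) :
  theta 0 0 tau z * theta 0 1 tau z = theta 0 1 (2 * tau) 0 * theta 0 1 (2 * tau) (2 * z).
Proof.
  rewrite <- (Cplus_0_r (theta 0 1 (2 * tau) 0 * _)).
  eapply has_sum_parity.
  - apply theta_mult_has_sum; auto.
  - rewrite Cmult_comm. eapply has_sum_ext; [|apply theta_mult_has_sum; auto].
    intros [c d]. unfold theta_term. cbn [fst snd]. rewrite <- !epi_plus.
    apply (epi_eq _ _ d). simpl INR. cring.
  (* The odd class drops out because it contains the factor theta11 (2 tau, 0) = 0. *)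
  - replace (RtoC 0) with (- (theta 1 1 (2 * tau) (2 * z) * theta 1 1 (2 * tau) 0))
      by (rewrite theta11_0 by auto; ring).
    eapply has_sum_ext; [|apply has_sum_opp, theta_mult_has_sum; auto].
    intros [c d]. unfold theta_term. cbn [fst snd]. rewrite <- !epi_plus.
    symmetry. apply (epi_neg _ _ (- d - 1)). simpl INR. cring.
Qed.

Lemma theta11_theta10 (z : C) :
  theta 1 1 tau z * theta 1 0 tau z = theta 0 1 (2 * tau) 0 * theta 1 1 (2 * tau) (2 * z).
Proof.
  rewrite <- (Cplus_0_r (theta 0 1 (2 * tau) 0 * _)).
  eapply has_sum_parity.
  - apply theta_mult_has_sum; auto.
  - rewrite Cmult_comm. eapply has_sum_ext; [|apply theta_mult_has_sum; auto].
    intros [c d]. unfold theta_term. cbn [fst snd]. rewrite <- !epi_plus.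
    apply (epi_eq _ _ 0). simpl INR. cring.
  (* Again a factor theta11 (2 tau, 0). As both characteristics are 1/2, the odd class has m + 1/2 =
     (c + 1) + (d + 1/2), whence the shift of c. *)
  - replace (RtoC 0) with (theta 0 1 (2 * tau) (2 * z) * theta 1 1 (2 * tau) 0)
      by (rewrite theta11_0 by auto; ring).
    eapply has_sum_ext; [|apply (has_sum_prod
      (fun c => theta_term 0 1 (2 * tau) (2 * z) (c + 1)) (theta_term 1 1 (2 * tau) 0))].
    + intros [c d]. unfold theta_term. cbn [fst snd]. rewrite <- !epi_plus.
      apply (epi_eq _ _ 0). simpl INR. cring.
    + apply (summable_inj (fun n => n + 1)%Z); [intros; lia|]. apply summable_theta; auto.
    + apply summable_theta; auto.
    + apply has_sum_shift, theta_has_sum; auto.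
    + apply theta_has_sum; auto.
Qed.

End Bilinear.

(** * The Lambert series S *)

Lemma Copp_mult_l (a b : C) : - a * b = - (a * b).
Proof. ring. Qed.

(** * Residues modulo 3 *)

Inductive residue := R0 | R1 | R2.

Definition rval (r : residue) : Z := match r with R0 => 0 | R1 => 1 | R2 => 2 end.

Definition residue_of (n : Z) : residue :=
  match (n mod 3)%Z with 0%Z => R0 | 1%Z => R1 | _ => R2 end.

Lemma rval_residue_of n : rval (residue_of n) = (n mod 3)%Z.
Proof.
  unfold residue_of. pose proof (Z.mod_pos_bound n 3 ltac:(lia)).
  destruct (n mod 3)%Z as [|[p|p|]|p] eqn:E; simpl; auto; try lia.

Qed.

Lemma residue_of_add (r : residue) b : residue_of (rval r + 3 * b) = r.
Proof.
  unfold residue_of. rewrite Z.mul_comm, Z_mod_plus_full. destruct r; reflexivity.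
Qed.

Lemma div3_add (r : residue) b : ((rval r + 3 * b) / 3 = b)%Z.
Proof. rewrite Z.mul_comm, Z_div_plus_full by lia. destruct r; reflexivity. Qed.

Lemma has_sum_residue (f : residue -> C) : has_sum f (f R0 + f R1 + f R2).
Proof.
  replace (f R0 + f R1 + f R2) with (Csum f [R0; R1; R2]) by (simpl; ring).
  apply has_sum_finite.
  - repeat constructor; simpl; intuition discriminate.
  - intros [| |] H; exfalso; apply H; simpl; auto.
Qed.

(** [bil l n] is twice the coefficient of [y^n] in
    [(1 + y) * (y^l - 1) / (y - 1) - (1 + y) / 2], and is antisymmetric under
    [(l, n) -> (1 - l, 1 - n)]. *)
Definition bil (l n : Z) : Z := (2 * Z.sgn (l - n) + Z.sgn n + Z.sgn (n - 1))%Z.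

Lemma bil_antisym l n : bil (1 - l) (1 - n) = (- bil l n)%Z.
Proof. unfold bil. lia. Qed.

Lemma bil_support l n : (Z.abs l + 1 < Z.abs n)%Z -> bil l n = 0%Z.
Proof. unfold bil. lia. Qed.

Lemma bil_bound l n : (Z.abs (bil l n) <= 4)%Z.
Proof. unfold bil. lia. Qed.

(** The row sum is given by its value at l = 0 and its increments 2 (y^l + y^{l+1}), y = [epi w],
    instead of a quotient by y - 1, so that y = 1 is covered as well. *)
Lemma bil_has_sum (w : C) (v : Z -> C) :
  v 0%Z = - (1 + epi w) ->
  (forall l, v (l + 1)%Z = v l + 2 * (epi (IZR l * w) + epi (IZR (l + 1) * w))) ->
  forall l, has_sum (fun n => IZR (bil l n) * epi (IZR n * w)) (v l).
Proof.
  intros H0 Hs.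
  pose (d := fun l n => if Z.eqb n l then epi (IZR n * w) else 0).
  assert (Hd : forall l, has_sum (d l) (epi (IZR l * w))).
  { intros l. replace (epi (IZR l * w)) with (d l l) by (unfold d; rewrite Z.eqb_refl; auto).
    apply has_sum_single. intros n Hn. unfold d. destruct (Z.eqb_spec n l); congruence. }
  assert (Hstep : forall l, has_sum (fun n => 2 * (d l n + d (l + 1)%Z n)) (v (l + 1)%Z - v l)).
  { intros l. rewrite Hs. replace (_ - v l)
      with (2 * (epi (IZR l * w) + epi (IZR (l + 1) * w))) by ring.
    apply has_sum_scal, has_sum_plus; auto. }
  assert (Hbil : forall l n, IZR (bil (l + 1) n) * epi (IZR n * w) =
            IZR (bil l n) * epi (IZR n * w) + 2 * (d l n + d (l + 1)%Z n)).
  { intros l n. unfold d. destruct (Z.eqb_spec n l); [|destruct (Z.eqb_spec n (l + 1))].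
    - replace (bil (l + 1) n) with (bil l n + 2)%Z by (unfold bil; lia).
      destruct (Z.eqb_spec n (l + 1)); [lia|]. cast. ring.
    - replace (bil (l + 1) n) with (bil l n + 2)%Z by (unfold bil; lia). cast. ring.
    - replace (bil (l + 1) n) with (bil l n) by (unfold bil; lia). ring. }
  intros l. induction l as [|l IH|l IH] using Z.peano_ind.
  - rewrite H0. replace (- (1 + epi w)) with (- epi (IZR 0 * w) + - epi (IZR 1 * w))
      by (rewrite Cmult_0_l, epi_0, Cmult_1_l; ring).
    eapply has_sum_ext; [|apply has_sum_plus; apply has_sum_opp; apply Hd].
    intros n. unfold d. destruct (Z.eqb_spec n 0) as [->|]; [|destruct (Z.eqb_spec n 1) as [->|]].
    + change (bil 0 0) with (-1)%Z. cbn [Z.eqb]. ring.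
    + change (bil 0 1) with (-1)%Z. cbn [Z.eqb Pos.eqb]. ring.
    + replace (bil 0 n) with 0%Z by (unfold bil; lia). ring.
  - rewrite <- Z.add_1_r. replace (v (l + 1)%Z) with (v l + (v (l + 1)%Z - v l)) by ring.
    eapply has_sum_ext; [|apply has_sum_plus; [apply IH|apply Hstep]].
    intros n. simpl. rewrite Hbil. auto.
  - pose proof (Hstep (Z.pred l)) as H. replace (Z.pred l + 1)%Z with l in H by lia.
    replace (v (Z.pred l)) with (v l - (v l - v (Z.pred l))) by ring.
    eapply has_sum_ext; [|apply has_sum_minus; [apply IH|apply H]].
    intros n. simpl. pose proof (Hbil (Z.pred l) n) as E.
    replace (Z.pred l + 1)%Z with l in E by lia. rewrite E. ring.
Qed.

(** * The product of S and theta01 as a triple series *)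

Section Kernel.
Context (tau : C) (Ht : (0 < Im tau)%R).
Let Ht2 : (0 < Im (2 * tau))%R := Im_double tau Ht.

Lemma sgauss_has_sum (w : C) :
  has_sum (fun l => sgauss tau l * epi (IZR l * w)) (theta 0 1 tau ((w - tau) / 2)).
Proof.
  eapply has_sum_ext; [|apply theta_has_sum; auto].
  intros l. unfold theta_term, sgauss. rewrite <- epi_plus. f_equal. simpl INR. field.
Qed.

(** The first factor 1 - [epi w] of the triple product vanishes. At w = 0 this says that the
    [sgauss l] add up to 0. *)
Lemma theta01_zero (w : C) : epi w = 1 -> theta 0 1 tau ((w - tau) / 2) = 0.
Proof.
  intros Hw. rewrite (has_sum_unique _ _ _ (sgauss_has_sum w) (jacobi_triple tau Ht w)).
  rewrite (poch_step w tau Ht), Hw. ring.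
Qed.

(** Quasi-periodicity under z -> z + k tau, the new argument being written as (w - tau) / 2 to match
    [sgauss_has_sum]. *)
Lemma theta01_shift (z : C) (k : Z) :
  theta 0 1 tau z = epi (IZR k + 2 * IZR k * z + IZR k ^ 2 * tau)
    * theta 0 1 tau ((2 * z + (2 * IZR k + 1) * tau - tau) / 2).
Proof.
  eapply theta_eq; [auto| |].
  - apply has_sum_scal.
    apply (has_sum_shift
      (fun l => sgauss tau l * epi (IZR l * (2 * z + (2 * IZR k + 1) * tau))) _ (- k)).
    apply sgauss_has_sum.
  - intros n. unfold theta_term, sgauss. rewrite <- !epi_plus. f_equal. simpl INR. cring.
Qed.

(** Since the [sgauss l] add up to 0, the part of [v l] independent of l contributes nothing, and 2
    (1 + y) y^l / (y - 1) remains. *)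
Lemma bil_row_generic (w : C) : epi w <> 1 ->
  exists v, (forall l, has_sum (fun n => IZR (bil l n) * epi (IZR n * w)) (v l)) /\
  has_sum (fun l => sgauss tau l * v l)
    (2 * (1 + epi w) / (epi w - 1) * theta 0 1 tau ((w - tau) / 2)).
Proof.
  intros Hw.
  assert (Hw' : epi w - 1 <> 0).
  { intros E. apply Hw. replace (epi w) with (epi w - 1 + 1) by ring. rewrite E. ring. }
  exists (fun l => (1 + epi w) * (2 * epi (IZR l * w) - 1 - epi w) / (epi w - 1)). split.
  - apply bil_has_sum.
    + rewrite Cmult_0_l, epi_0. field. auto.
    + intros l. replace (epi (IZR (l + 1) * w)) with (epi w * epi (IZR l * w))
        by (rewrite <- epi_plus; f_equal; cring). field. auto.
  - pose proof (sgauss_has_sum 0) as S0. rewrite theta01_zero in S0 by apply epi_0.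
    replace (_ * theta _ _ _ _) with
      (2 * (1 + epi w) / (epi w - 1) * theta 0 1 tau ((w - tau) / 2)
       - (1 + epi w) ^ 2 / (epi w - 1) * 0) by ring.
    eapply has_sum_ext; [|apply has_sum_minus; apply has_sum_scal;
                          [apply (sgauss_has_sum w)|apply S0]].
    intros l. simpl. rewrite (Cmult_0_r (IZR l)), epi_0. field. auto.
Qed.

(** The case y = 1, where the quotient (y^l - 1) / (y - 1) becomes l: [v l] is 4 l - 2, and the
    first moment of [sgauss] is Jacobi's cube. *)
Lemma bil_row_one :
  exists v, (forall l, has_sum (fun n => IZR (bil l n) * epi (IZR n * 0)) (v l)) /\
  has_sum (fun l => sgauss tau l * v l) (- 4 * qinf tau ^ 3).
Proof.
  exists (fun l => 4 * IZR l - 2). split.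
  - apply bil_has_sum.
    + rewrite epi_0. ring.
    + intros l. rewrite !Cmult_0_r, epi_0. cast. ring.
  - pose proof (sgauss_has_sum 0) as S0. rewrite theta01_zero in S0 by apply epi_0.
    replace (- 4 * qinf tau ^ 3) with (4 * - qinf tau ^ 3 - 2 * 0) by ring.
    eapply has_sum_ext; [|apply has_sum_minus; apply has_sum_scal;
                          [apply (jacobi_cube tau Ht)|apply S0]].
    intros l. simpl. rewrite (Cmult_0_r (IZR l)), epi_0. ring.
Qed.

(** The factor x^{2k+1} q^{(k+1/2)^2} of S times the quasi-periodicity factor between theta01 at z
    and at z + k tau. *)
Definition kcoef (z : C) (k : Z) : C :=
  epi (2 * z * (3 * IZR k + 1) + tau * (3 * IZR k ^ 2 + 2 * IZR k + 1 / 2) + IZR k).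

(** [epi (kpoint z k)] is the y_k of the header. *)
Definition kpoint (z : C) (k : Z) : C := 2 * z + (2 * IZR k + 1) * tau.

(** Away from the zeros of theta01, summation over n, then l, then k yields -2 S theta01. *)
Definition triple (z : C) (p : Z * (Z * Z)) : C :=
  let (k, ln) := p in let (l, n) := ln in
  kcoef z k * (sgauss tau l * (IZR (bil l n) * epi (IZR n * kpoint z k))).

(** The quadratic part 3 k^2 + 2 k n + l^2 contains no n^2 and is indefinite; the support of [bil]
    allows a part of l^2 to be traded for n^2. *)
Lemma triple_exponent_bound (k l n : R) :
  (Rabs n <= Rabs l + 1 ->
   (k ^ 2 + l ^ 2 + n ^ 2) / 8 - 3 * (Rabs k + Rabs l + Rabs n) - 1
   <= 3 * k ^ 2 + 2 * k + 1 / 2 + (2 * k + 1) * n + l ^ 2 - l)%R.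
Proof.
  intros H.
  pose proof (Rle_abs (- k)). pose proof (Rle_abs l). pose proof (Rle_abs (- n)).
  rewrite !Rabs_Ropp in *.
  pose proof (Rabs_pos k). pose proof (Rabs_pos l). pose proof (Rabs_pos n).
  pose proof (pow2_abs l) as El. pose proof (pow2_abs n) as En.
  assert (n ^ 2 <= l ^ 2 + 2 * Rabs l + 1)%R by (rewrite <- El, <- En; nra).
  (* The coefficients are 3 - 1/8 and 7/8 - 1/8, once the remaining 7/8 l^2 has been exchanged for
     7/8 n^2. *)
  assert (0 <= 23 / 8 * k ^ 2 + 2 * (k * n) + 6 / 8 * n ^ 2)%R.
  { replace (23 / 8 * k ^ 2 + 2 * (k * n) + 6 / 8 * n ^ 2)%R
      with (23 / 8 * (k + 8 / 23 * n) ^ 2 + (6 / 8 - 8 / 23) * n ^ 2)%R by field.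
    pose proof (pow2_ge_0 (k + 8 / 23 * n)). pose proof (pow2_ge_0 n). lra. }
  lra.
Qed.

Lemma summable_triple (z : C) : summable (triple z).
Proof.
  pose proof PI_RGT_0 as HPI.
  set (s := Im tau). set (y := Im z). assert (Hs : (0 < s)%R) by exact Ht.
  (* The summand 4 in the last constant absorbs |[bil]| <= 4 <= exp 4. *)
  apply (summable_gauss3 _ (PI * (s / 8)) (PI * (3 * s + 6 * Rabs y))
           (PI * (s + 2 * Rabs y) + 4)).
  { apply Rmult_lt_0_compat; lra. }
  intros k l n. unfold triple.
  destruct (Z_lt_le_dec (Z.abs l + 1) (Z.abs n)) as [Hn|Hn].
  { rewrite bil_support by auto. rewrite Cmult_0_l, !Cmult_0_r, Cmod_0.
    unfold gauss. rewrite <- !exp_plus. left. apply exp_pos. }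
  apply IZR_le in Hn. rewrite plus_IZR, !abs_IZR in Hn.
  pose proof (triple_exponent_bound (IZR k) (IZR l) (IZR n) Hn) as Hb.
  assert (Hbil : (Rabs (IZR (bil l n)) <= 4)%R).
  { rewrite <- abs_IZR. apply (IZR_le _ 4). apply bil_bound. }
  rewrite !Cmod_mult, Cmod_R. unfold kcoef, sgauss, kpoint, gauss. rewrite !Cmod_epi.
  apply Rle_trans with (4 * (exp (- (PI * (s * (3 * IZR k ^ 2 + 2 * IZR k + 1 / 2 +
     (2 * IZR k + 1) * IZR n + IZR l ^ 2 - IZR l) + 2 * y * (3 * IZR k + 1 + IZR n))))))%R.
  - rewrite (Rmult_comm (Rabs _)), <- !Rmult_assoc, <- !exp_plus, Rmult_comm.
    apply Rmult_le_compat; auto; [apply Rabs_pos|left; apply exp_pos|].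
    right. f_equal. unfold s, y, Im. simpl. field.
  - apply Rle_trans with (exp 4 * exp (- (PI * (s * (3 * IZR k ^ 2 + 2 * IZR k + 1 / 2 +
     (2 * IZR k + 1) * IZR n + IZR l ^ 2 - IZR l) + 2 * y * (3 * IZR k + 1 + IZR n)))))%R.
    + apply Rmult_le_compat_r; [left; apply exp_pos|]. pose proof (exp_ineq1_le 4). lra.
    + rewrite <- !exp_plus. apply exp_le_compat.
      set (K := Rabs (IZR k)) in *. set (L := Rabs (IZR l)) in *. set (N := Rabs (IZR n)) in *.
      assert (Hy : (- (y * (3 * IZR k + 1 + IZR n)) <= Rabs y * (3 * K + 1 + N))%R).
      { eapply Rle_trans; [apply Rle_abs|]. rewrite Rabs_Ropp, Rabs_mult.
        apply Rmult_le_compat_l; [apply Rabs_pos|].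
        eapply Rle_trans; [apply Rabs_triang|]. apply Rplus_le_compat_r.
        eapply Rle_trans; [apply Rabs_triang|].
        rewrite Rabs_mult, (Rabs_pos_eq 3), (Rabs_pos_eq 1) by lra. fold K. lra. }
      apply (Rmult_le_compat_l s) in Hb; [|lra].
      assert (Hyp : (0 <= Rabs y)%R) by apply Rabs_pos.
      assert (HL : (0 <= L)%R) by apply Rabs_pos.
      assert (HN : (0 <= N)%R) by apply Rabs_pos.
      assert (HyL : (0 <= Rabs y * L)%R) by (apply Rmult_le_pos; auto).
      assert (HyN : (0 <= Rabs y * N)%R) by (apply Rmult_le_pos; auto).
      set (X := (s * (3 * IZR k ^ 2 + 2 * IZR k + 1 / 2 + (2 * IZR k + 1) * IZR n
                      + IZR l ^ 2 - IZR l))%R) in *.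
      assert (Hfin : (- (X + 2 * y * (3 * IZR k + 1 + IZR n)) <=
         - (s / 8) * (IZR k ^ 2 + IZR l ^ 2 + IZR n ^ 2)
         + (3 * s + 6 * Rabs y) * (K + L + N) + (s + 2 * Rabs y))%R) by lra.
      apply (Rmult_le_compat_l PI) in Hfin; lra.
Qed.

Lemma triple_row (z : C) (k : Z) (v : Z -> C) (s : C) :
  (forall l, has_sum (fun n => IZR (bil l n) * epi (IZR n * kpoint z k)) (v l)) ->
  has_sum (fun l => sgauss tau l * v l) s ->
  has_sum (fun ln => triple z (k, ln)) (kcoef z k * s).
Proof.
  intros Hv Hs.
  destruct (summable_has_sum (fun ln => triple z (k, ln))) as [t Ht'].
  { apply (summable_inj (fun ln => (k, ln)) (triple z)); [congruence|apply summable_triple]. }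
  replace (kcoef z k * s) with t; auto.
  apply (has_sum_unique (fun l => kcoef z k * (sgauss tau l * v l))).
  - eapply has_sum_fubini; [apply Ht'|]. intros l. simpl.
    apply has_sum_scal, has_sum_scal, Hv.
  - apply has_sum_scal, Hs.
Qed.

(** [th3 r] spans, with r = 0, 1, 2, the Laurent series in x = e^{2 pi i z} with the
    quasi-periodicity of theta11 theta10 theta00. *)
Definition th3_term (z : C) (r : residue) (a : Z) : C :=
  epi (2 * z * (3 * IZR a + IZR (rval r)) + tau * (3 * IZR a ^ 2 + 2 * IZR (rval r) * IZR a)
       + IZR a).

Definition th3 (z : C) (r : residue) : C := CSeriesZ (th3_term z r).

Lemma summable_th3 z r : summable (th3_term z r).
Proof.
  apply (summable_epi _ (3 * Im tau) (6 * Im z + 2 * IZR (rval r) * Im tau)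
    (2 * IZR (rval r) * Im z)); [lra|].
  intros n. unfold Im. simpl. ring.
Qed.

Lemma th3_has_sum z r : has_sum (th3_term z r) (th3 z r).
Proof.
  destruct (summable_has_sum _ (summable_th3 z r)) as [s Hs].
  unfold th3. rewrite (has_sum_CSeriesZ _ _ (summable_th3 z r) Hs). auto.
Qed.

(** With k = a - b and n = 3 b + r - 1, the power of x in [triple] is 3 k + 1 + n = 3 a + r;
    splitting off [th3_term] leaves this factor, free of z and a. *)
Definition gcoef (r : residue) (p : Z * Z) : C :=
  IZR (bil (snd p) (3 * fst p + rval r - 1)) *
  epi (tau * (- 3 * IZR (fst p) ^ 2 + IZR (fst p) * (3 - 2 * IZR (rval r))
              + IZR (rval r) - 1 / 2 + IZR (snd p) ^ 2 - IZR (snd p))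
       - IZR (fst p) + IZR (snd p)).

Lemma triple_factor z r a b l :
  triple z (a - b, (l, 3 * b + rval r - 1))%Z = th3_term z r a * gcoef r (b, l).
Proof.
  unfold triple, kcoef, sgauss, kpoint, th3_term, gcoef. cbn [fst snd].
  match goal with |- ?A * (?B * (?X * ?D)) = ?E * (?Y * ?F) =>
    replace (A * (B * (X * D))) with (X * (A * B * D)) by ring;
    replace (E * (Y * F)) with (Y * (E * F)) by ring end.
  f_equal. rewrite <- !epi_plus. f_equal. cring.
Qed.

(** For z = 0 and a = 0 the factor [th3_term] is 1, which makes [gcoef r] a subfamily of
    [triple 0]. *)
Lemma summable_gcoef r : summable (gcoef r).
Proof.
  eapply summable_ext;
    [|apply (summable_inj (fun p : Z * Z => (0 - fst p, (snd p, 3 * fst p + rval r - 1))%Z)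
               (triple 0))].
  - intros [b l]. cbn [fst snd]. rewrite triple_factor. unfold th3_term.
    replace (2 * 0 * _ + _ + _) with (RtoC 0) by ring. rewrite epi_0. ring.
  - intros [b l] [b' l'] H. injection H as H1 H2 H3. f_equal; lia.
  - apply summable_triple.
Qed.

(** Regrouped by powers of x, the series is a combination of the [th3 z r] with constant
    coefficients, and the antisymmetry of [bil] leaves one of them free. The combination
    [th3 z R1 + epi tau * th3 z R2] is the odd one. *)
Lemma triple_decomposition :
  exists g : C, forall z s, has_sum (triple z) s ->
    s = g * (th3 z R1 + epi tau * th3 z R2).
Proof.
  destruct (summable_has_sum _ (summable_gcoef R0)) as [g0 H0].
  destruct (summable_has_sum _ (summable_gcoef R1)) as [g1 H1].
  destruct (summable_has_sum _ (summable_gcoef R2)) as [g2 H2].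
  (* For r = 0 the reflection (b, l) -> (1 - b, 1 - l) sends n to 1 - n and changes the sign of
     [bil]. *)
  assert (E0 : g0 = 0).
  { apply (has_sum_antisym (fun p => (1 - fst p, 1 - snd p)%Z) (gcoef R0)); auto.
    - intros [b l]. cbn [fst snd]. f_equal; lia.
    - intros [b l]. unfold gcoef. cbn [fst snd rval].
      replace (3 * (1 - b) + 0 - 1)%Z with (1 - (3 * b + 0 - 1))%Z by lia.
      rewrite bil_antisym, opp_IZR, RtoC_opp, Copp_mult_l.
      do 2 f_equal. apply (epi_eq _ _ (b - l)). cring. }
  (* The reflection (b, l) -> (- b, 1 - l) exchanges the classes 1 and 2. *)
  assert (E2 : g2 = epi tau * g1).
  { apply (has_sum_unique (fun p => gcoef R2 (- fst p, 1 - snd p)%Z)).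
    - apply (has_sum_reindex (fun p => (- fst p, 1 - snd p)%Z) (fun p => (- fst p, 1 - snd p)%Z));
      auto; intros [b l]; cbn [fst snd]; f_equal; lia.
    - eapply has_sum_ext; [|apply has_sum_scal, H1].
      intros [b l]. unfold gcoef. cbn [fst snd rval].
      replace (3 * - b + 2 - 1)%Z with (1 - (3 * b + 1 - 1))%Z by lia.
      rewrite bil_antisym, opp_IZR, RtoC_opp, Copp_mult_l.
      match goal with |- ?A * (?X * ?B) = - (?X * ?D) =>
        replace (A * (X * B)) with (X * (A * B)) by ring;
        replace (- (X * D)) with (X * - D) by ring end.
      f_equal. rewrite <- epi_plus. apply (epi_neg _ _ (l - b - 1)). cring. }
  exists g1. intros z s Hs.
  assert (Hr : has_sum (fun r => th3 z r * match r with R0 => g0 | R1 => g1 | R2 => g2 end) s).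
  { eapply (has_sum_fubini (fun p : residue * (Z * (Z * Z)) =>
      let (r, abl) := p in th3_term z r (fst abl) * gcoef r (snd abl))).
    - eapply has_sum_ext;
        [|apply (has_sum_reindex
            (fun p : residue * (Z * (Z * Z)) => let '(r, (a, (b, l))) := p in
               (a - b, (l, 3 * b + rval r - 1))%Z)
            (* The inverse substitution: n + 1 = 3 b + r is divided by 3 with remainder. *)
            (fun q : Z * (Z * Z) => let '(k, (l, n)) := q in
               (residue_of (n + 1), (k + (n + 1) / 3, ((n + 1) / 3, l)))%Z)); [| |apply Hs]].
      + intros [r [a [b l]]]. cbn [fst snd]. apply triple_factor.
      + intros [r [a [b l]]].
        replace (3 * b + rval r - 1 + 1)%Z with (rval r + 3 * b)%Z by lia.
        rewrite residue_of_add, div3_add. do 2 f_equal. lia.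
      + intros [k [l n]]. rewrite rval_residue_of.
        pose proof (Z.div_mod (n + 1) 3 ltac:(lia)). f_equal; [lia|f_equal; lia].
    - intros r. apply (has_sum_prod (th3_term z r) (gcoef r));
        [apply summable_th3|apply summable_gcoef|apply th3_has_sum|destruct r; auto]. }
  rewrite (has_sum_unique _ _ _ Hr (has_sum_residue _)), E0, E2. ring.
Qed.

(** With m = a + b and n = a - 2 b + r - 1, the power 2 m + 1 + n of x is again 3 a + r, and 2 (a +
    b)^2 + (a - 2 b)^2 = 3 a^2 + 6 b^2 has no cross term, so a factor free of z and a remains. *)
Definition fcoef (r : residue) (b : Z) : C :=
  epi (tau * (6 * IZR b ^ 2 + 2 * IZR b - 4 * IZR b * (IZR (rval r) - 1)
              + (IZR (rval r) - 1) ^ 2 + 1 / 2) + IZR b + 1 / 2).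

Lemma summable_fcoef r : summable (fcoef r).
Proof.
  apply (summable_epi _ (6 * Im tau) ((2 - 4 * (IZR (rval r) - 1)) * Im tau)
    (((IZR (rval r) - 1) ^ 2 + 1 / 2) * Im tau)); [lra|].
  intros n. unfold Im. simpl. field.
Qed.

Lemma theta_product_decomposition :
  exists f : C, forall z, theta 1 1 (2 * tau) (2 * z) * theta 0 0 tau z
    = f * (th3 z R1 + epi tau * th3 z R2).
Proof.
  destruct (summable_has_sum _ (summable_fcoef R0)) as [g0 H0].
  destruct (summable_has_sum _ (summable_fcoef R1)) as [g1 H1].
  destruct (summable_has_sum _ (summable_fcoef R2)) as [g2 H2].
  assert (E0 : g0 = 0).
  { apply (has_sum_antisym (fun b => - 1 - b)%Z (fcoef R0)); auto.
    - intros; lia.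
    - intros b. unfold fcoef. cbn [rval]. apply (epi_neg _ _ (- b - 1)). cring. }
  assert (E2 : g2 = epi tau * g1).
  { apply (has_sum_unique (fun b => fcoef R2 (- b)%Z)).
    - apply (has_sum_reindex Z.opp Z.opp); auto; intros; lia.
    - eapply has_sum_ext; [|apply has_sum_scal, H1].
      intros b. unfold fcoef. cbn [rval]. rewrite <- epi_plus.
      apply (epi_eq _ _ b). cring. }
  exists g1. intros z.
  assert (Hr : has_sum (fun r => th3 z r * match r with R0 => g0 | R1 => g1 | R2 => g2 end)
                 (theta 1 1 (2 * tau) (2 * z) * theta 0 0 tau z)).
  { eapply (has_sum_fubini (fun p : residue * (Z * Z) =>
      let (r, ab) := p in th3_term z r (fst ab) * fcoef r (snd ab))).
    - eapply has_sum_ext;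
        [|apply (has_sum_reindex
            (fun p : residue * (Z * Z) => let '(r, (a, b)) := p in
               (a + b, a - 2 * b + rval r - 1)%Z)
            (fun q : Z * Z => let '(m, n) := q in
               let b := ((m - n + 1) / 3)%Z in
               (* Here m - n + 1 = 3 b + (2 - r), so the residue comes out reflected. *)
               (match residue_of (m - n + 1) with R0 => R2 | R1 => R1 | R2 => R0 end,
                (m - b, b))%Z)); [| |apply theta_mult_has_sum; auto]].
      + intros [r [a b]]. cbn [fst snd]. unfold theta_term, th3_term, fcoef.
        rewrite <- !epi_plus. f_equal. simpl INR. cring.
      + intros [r [a b]].
        replace (a + b - (a - 2 * b + rval r - 1) + 1)%Z with
          (rval (match r with R0 => R2 | R1 => R1 | R2 => R0 end) + 3 * b)%Z
          by (destruct r; cbn [rval]; lia).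
        cbv zeta. rewrite residue_of_add, div3_add. destruct r; cbn [rval]; repeat (f_equal; try lia).
      + intros [m n]. cbv zeta.
        pose proof (Z.div_mod (m - n + 1) 3 ltac:(lia)) as Hd.
        rewrite <- rval_residue_of in Hd.
        destruct (residue_of (m - n + 1)); cbn [rval] in *; f_equal; lia.
    - intros r. apply (has_sum_prod (th3_term z r) (fcoef r));
        [apply summable_th3|apply summable_fcoef|apply th3_has_sum|destruct r; auto]. }
  rewrite (has_sum_unique _ _ _ Hr (has_sum_residue _)), E0, E2. ring.
Qed.

(** Now y_k = q^k, and theta01 vanishes at every z + k tau. For k <> 0 the row is a finite multiple
    of that zero; for k = 0 it has y = 1 and equals Jacobi's cube up to a factor. *)
Lemma triple_half_period : has_sum (triple (- tau / 2)) (- 4 * epi (- tau / 2) * qinf tau ^ 3).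
Proof.
  destruct (summable_has_sum _ (summable_triple (- tau / 2))) as [s Hs].
  replace (- 4 * epi (- tau / 2) * qinf tau ^ 3) with s; auto.
  assert (Hp : forall k, kpoint (- tau / 2) k = 2 * tau * IZR k)
    by (intros k; unfold kpoint; field).
  pose (g := fun k : Z => if Z.eqb k 0 then epi (- tau / 2) * (- 4 * qinf tau ^ 3) else 0).
  replace (- 4 * epi (- tau / 2) * qinf tau ^ 3) with (g 0%Z) by (unfold g; simpl; ring).
  apply (has_sum_unique g).
  - eapply has_sum_fubini; [apply Hs|]. intros k. unfold g.
    destruct (Z.eqb_spec k 0) as [->|Hk].
    + destruct bil_row_one as (v & Hv & Hsv).
      replace (epi (- tau / 2)) with (kcoef (- tau / 2) 0)
        by (unfold kcoef; f_equal; field).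
      apply (triple_row _ _ v); auto.
      rewrite Hp. replace (2 * tau * IZR 0) with (RtoC 0) by ring. auto.
    + destruct (bil_row_generic (kpoint (- tau / 2) k)) as (v & Hv & Hsv).
      { rewrite Hp. apply epi_neq_1.
        replace (Im _) with (2 * Im tau * IZR k)%R by (unfold Im; simpl; ring).
        apply Rmult_integral_contrapositive. split; [lra|]. apply not_0_IZR; exact Hk. }
      assert (E : theta 0 1 tau ((kpoint (- tau / 2) k - tau) / 2) = 0).
      { pose proof (theta01_shift (- tau / 2) k) as Hsh.
        pose proof (theta01_zero 0 epi_0) as Hz.
        replace ((0 - tau) / 2) with (- tau / 2) in Hz by field.
        rewrite Hz in Hsh. apply NNPP. intros Hn. symmetry in Hsh. revert Hsh.
        apply Cmult_neq_0; [apply epi_neq_0|exact Hn]. }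
      rewrite E, Cmult_0_r in Hsv.
      replace (RtoC 0) with (kcoef (- tau / 2) k * 0) by ring.
      apply (triple_row _ _ v); auto.
  - apply has_sum_single. intros k Hk. unfold g. destruct (Z.eqb_spec k 0); [lia|auto].
Qed.

Lemma theta_product_half_period :
  theta 1 1 (2 * tau) (2 * (- tau / 2)) * theta 0 0 tau (- tau / 2)
  = Ci * epi (- tau / 2) * theta 0 1 (2 * tau) 0 * theta 0 0 tau (- tau / 2).
Proof.
  f_equal. eapply theta_eq; [auto|apply has_sum_scal, theta_has_sum; auto|].
  intros n. unfold theta_term. rewrite <- epi_half, <- !epi_plus. f_equal. simpl INR. field.
Qed.

(** Both decompositions are multiples of the same function, and their values at - tau / 2 give the
    ratio of the scalars. *)
Lemma triple_sum (z s : C) : has_sum (triple z) s ->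
  s = 2 * Ci * theta 0 1 (2 * tau) 0 * (theta 1 1 (2 * tau) (2 * z) * theta 0 0 tau z).
Proof.
  intros Hs.
  destruct triple_decomposition as [g Hg]. destruct theta_product_decomposition as [f Hf].
  pose proof (Hg _ _ triple_half_period) as E1.
  pose proof (Hf (- tau / 2)) as E2. rewrite theta_product_half_period in E2.
  rewrite (Hg _ _ Hs), Hf.
  pose proof (theta_constants_cube tau Ht) as E3.
  set (c := theta 0 1 (2 * tau) 0) in *. set (W := theta 0 0 tau (- tau / 2)) in *.
  set (x := epi (- tau / 2)) in *.
  set (T0 := th3 (- tau / 2) R1 + epi tau * th3 (- tau / 2) R2) in *.
  set (T := th3 z R1 + epi tau * th3 z R2).
  pose proof (qinf_neq_0 tau Ht) as Hq. pose proof (epi_neq_0 (- tau / 2)) as Hx. fold x in Hx.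
  assert (HCi : Ci * Ci = - (1)) by (apply injective_projections; simpl; ring).
  (* Being 2 (q; q)^3, this product is nonzero, which makes [c], [W] and then [T0] invertible. *)
  assert (Hq3 : c ^ 2 * W <> 0).
  { rewrite E3. apply Cmult_neq_0; [intros E; apply RtoC_inj in E; lra|].
    simpl. repeat apply Cmult_neq_0; auto using C1_nz. }
  assert (Hc : c <> 0) by (intros E; apply Hq3; rewrite E; ring).
  assert (HW : W <> 0) by (intros E; apply Hq3; rewrite E; ring).
  assert (HCi0 : Ci <> 0).
  { intros E. rewrite E, Cmult_0_l in HCi. apply C1_nz.
    replace (RtoC 1) with (- - (1)) by ring. rewrite <- HCi. ring. }
  assert (HT0 : T0 <> 0).
  { intros E. rewrite E, Cmult_0_r in E2. revert E2.
    repeat apply Cmult_neq_0; auto. }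
  assert (E4 : g * T0 = 2 * Ci * c * (f * T0)).
  { rewrite <- E1, <- E2.
    replace (- 4 * x * qinf tau ^ 3) with (- 2 * x * (2 * qinf tau ^ 3)) by ring.
    rewrite <- E3.
    replace (2 * Ci * c * (Ci * x * c * W)) with (2 * (Ci * Ci) * x * (c ^ 2 * W)) by ring.
    rewrite HCi. ring. }
  replace g with (g * T0 / T0) by (field; auto). rewrite E4. field. auto.
Qed.

(** The k-th term of S. *)
Definition lambert (z : C) (k : Z) : C :=
  theta_term 1 0 (2 * tau) (2 * z) k * ((1 + epi (kpoint z k)) / (1 - epi (kpoint z k))).

Lemma epi_kpoint_neq_1 (z : C) (k : Z) : theta 0 1 tau z <> 0 -> epi (kpoint z k) <> 1.
Proof.
  intros H0 E. apply H0. rewrite (theta01_shift z k).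
  pose proof (theta01_zero _ E) as Hz. unfold kpoint in Hz. rewrite Hz. ring.
Qed.

(** Row k of the triple series is -2 theta01 times the k-th term of S; dividing by this constant
    gives both convergence and value. *)
Lemma lambert_has_sum (z : C) : theta 0 1 tau z <> 0 ->
  summable (lambert z) /\
  has_sum (lambert z)
    (- Ci * theta 1 1 tau z * theta 1 0 tau z * theta 0 0 tau z / theta 0 1 tau z).
Proof.
  intros H0.
  destruct (summable_has_sum _ (summable_triple z)) as [s Hs].
  assert (Hrow : forall k, has_sum (fun ln => triple z (k, ln))
                   (- 2 * theta 0 1 tau z * lambert z k)).
  { intros k. pose proof (epi_kpoint_neq_1 z k H0) as Hk.
    destruct (bil_row_generic _ Hk) as (v & Hv & Hsv).
    replace (- 2 * theta 0 1 tau z * lambert z k) with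
      (kcoef z k * (2 * (1 + epi (kpoint z k)) / (epi (kpoint z k) - 1)
                    * theta 0 1 tau ((kpoint z k - tau) / 2))).
    - apply (triple_row _ _ v); auto.
    - rewrite (theta01_shift z k). fold (kpoint z k).
      assert (Hkc : kcoef z k = theta_term 1 0 (2 * tau) (2 * z) k
                * epi (IZR k + 2 * IZR k * z + IZR k ^ 2 * tau)).
      { unfold kcoef, theta_term. rewrite <- epi_plus. f_equal. simpl INR. field. }
      rewrite Hkc. unfold lambert. field. split; intros E; apply Hk.
      + replace (epi (kpoint z k)) with (1 - (1 - epi (kpoint z k))) by ring. rewrite E. ring.
      + replace (epi (kpoint z k)) with (epi (kpoint z k) - 1 + 1) by ring. rewrite E. ring. }
  assert (Hl : forall k, / (- 2 * theta 0 1 tau z) * (- 2 * theta 0 1 tau z * lambert z k)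
                 = lambert z k) by (intros k; field; auto).
  split.
  - eapply summable_ext; [apply Hl|]. apply summable_scal.
    apply (summable_rows (triple z)); [apply summable_triple|apply Hrow].
  - eapply has_sum_ext; [apply Hl|].
    replace (- Ci * _ * _ * _ / _) with (/ (- 2 * theta 0 1 tau z) * s).
    + apply has_sum_scal. eapply has_sum_fubini; [apply Hs|apply Hrow].
    + rewrite (triple_sum z s Hs).
      replace (- Ci * theta 1 1 tau z * theta 1 0 tau z)
        with (- Ci * (theta 1 1 tau z * theta 1 0 tau z)) by ring.
      rewrite theta11_theta10 by auto. field. auto.
Qed.

End Kernel.

(** * Characters *)

(** Moves the prefactor e^{-2 pi i m t} of [Phi1] and [Phi2] into the terms, where it completes the
    exponents to those of theta terms. *)
Lemma CSeriesZ_scal (c : C) (f g : Z -> C) (s : C) :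
  c <> 0 -> (forall n, c * f n = g n) -> summable g -> has_sum g s -> c * CSeriesZ f = s.
Proof.
  intros Hc Hfg Sg Hg.
  assert (Hf : forall n, / c * g n = f n) by (intros n; rewrite <- Hfg; field; auto).
  rewrite (has_sum_CSeriesZ f (/ c * s)).
  - field. auto.
  - eapply summable_ext; [apply Hf|]. apply summable_scal; auto.
  - eapply has_sum_ext; [apply Hf|]. apply has_sum_scal; auto.
Qed.

Lemma has_sum_even_odd (h : Z -> C) (s s0 s1 : C) :
  has_sum h s -> has_sum (fun j => h (2 * j)%Z) s0 ->
  has_sum (fun j => h (- 2 * j - 1)%Z) s1 -> s = s0 + s1.
Proof.
  intros H H0 H1.
  apply (has_sum_unique (fun b : bool => if b then s0 else s1));
    [|apply (has_sum_bool (fun b : bool => if b then s0 else s1))].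
  apply (has_sum_fubini (fun p : bool * Z =>
    h (if fst p then 2 * snd p else - 2 * snd p - 1)%Z)).
  - apply (has_sum_reindex (fun p : bool * Z => if fst p then 2 * snd p else - 2 * snd p - 1)%Z
      (fun n => if Z.even n then (true, n / 2)%Z else (false, (- n - 1) / 2)%Z)); auto.
    + intros [[|] j]; cbn [fst snd].
      * rewrite Z.even_mul. cbn [Z.even orb]. rewrite Z.mul_comm, Z.div_mul by lia. auto.
      * replace (- 2 * j - 1)%Z with (2 * (- j - 1) + 1)%Z by lia.
        rewrite Z.even_add, Z.even_mul. cbn [Z.even orb Bool.eqb]. f_equal.
        replace (- (2 * (- j - 1) + 1) - 1)%Z with (j * 2)%Z by lia. apply Z.div_mul. lia.
    + intros n. pose proof (Zmod_even n) as He. pose proof (Z.div_mod n 2 ltac:(lia)).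
      destruct (Z.even n); cbn [fst snd]; [lia|].
      replace (- n - 1)%Z with (- (n / 2 + 1) * 2)%Z by lia. rewrite Z.div_mul; lia.
  - intros [|]; cbn [fst snd]; auto.
Qed.

(** The terms of [Phi1] are the even-indexed terms of one bilateral series, and those of - [Phi2]
    the odd-indexed ones, with index - 2 j - 1. *)
Lemma Phi_has_sum (m s : R) (tau z1 z2 t : C) (h : Z -> C) (v : C) :
  summable h -> has_sum h v ->
  (forall j, Cexp (- (2 * PI * Ci * m * t)) *
    (Cexp (2 * PI * Ci * m * IZR j * (z1 + z2) + 2 * PI * Ci * s * z1)
    * Cexp (2 * PI * Ci * tau * (m * IZR j ^ 2 + s * IZR j))
    / (1 - Cexp (2 * PI * Ci * z1) * Cexp (2 * PI * Ci * IZR j * tau))) = h (2 * j)%Z) ->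
  (forall j, Cexp (- (2 * PI * Ci * m * t)) *
    (Cexp (- (2 * PI * Ci * m * IZR j * (z1 + z2)) - 2 * PI * Ci * s * z2)
    * Cexp (2 * PI * Ci * tau * (m * IZR j ^ 2 + s * IZR j))
    / (1 - Cexp (- (2 * PI * Ci * z2)) * Cexp (2 * PI * Ci * IZR j * tau)))
    = - (1) * h (- 2 * j - 1)%Z) ->
  Phi m s tau z1 z2 t = v.
Proof.
  intros Sh Hh H1 H2.
  assert (Hc : Cexp (- (2 * PI * Ci * m * t)) <> 0).
  { intros E. pose proof (Cmod_Cexp (- (2 * PI * Ci * m * t))) as Hm.
    rewrite E, Cmod_0 in Hm. pose proof (exp_pos (Re (- (2 * PI * Ci * m * t)))). lra. }
  assert (S0 : summable (fun j => h (2 * j)%Z))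
    by (apply (summable_inj (fun j => 2 * j)%Z); auto; intros; lia).
  assert (S1 : summable (fun j => h (- 2 * j - 1)%Z))
    by (apply (summable_inj (fun j => - 2 * j - 1)%Z); auto; intros; lia).
  destruct (summable_has_sum _ S0) as [s0 Hs0].
  destruct (summable_has_sum _ S1) as [s1 Hs1].
  unfold Phi, Phi1, Phi2.
  rewrite (CSeriesZ_scal _ _ _ _ Hc H1 S0 Hs0).
  rewrite (CSeriesZ_scal _ _ _ _ Hc H2 (summable_scal _ _ S1) (has_sum_scal _ _ _ Hs1)).
  rewrite (has_sum_even_odd h v s0 s1 Hh Hs0 Hs1). ring.
Qed.

Lemma Cmult_div_assoc (a b c : C) : a * (b / c) = a * b / c.
Proof. unfold Cdiv. ring. Qed.

(** * The functions Phi with m = 2 and the characters *)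

Section Characters.
Context (tau : C) (Ht : (0 < Im tau)%R).
Let Ht2 : (0 < Im (2 * tau))%R := Im_double tau Ht.

(** The k-th term of D. *)
Definition alternating (z : C) (k : Z) : C := epi (IZR k) * theta_term 1 0 (2 * tau) (2 * z) k.

Lemma alternating_eq z k : alternating z k = - Ci * theta_term 1 1 (2 * tau) (2 * z) k.
Proof.
  assert (E : theta_term 1 1 (2 * tau) (2 * z) k = Ci * alternating z k).
  { unfold alternating, theta_term. rewrite <- epi_half, <- !epi_plus. f_equal.
    simpl INR. field. }
  rewrite E. replace (- Ci * (Ci * _)) with (- (Ci * Ci) * alternating z k) by ring.
  replace (Ci * Ci) with (- (1)) by (apply injective_projections; simpl; ring). ring.
Qed.

Lemma alternating_has_sum z :
  summable (alternating z) /\ has_sum (alternating z) (- Ci * theta 1 1 (2 * tau) (2 * z)).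
Proof.
  split.
  - eapply summable_ext; [intros k; symmetry; apply alternating_eq|].
    apply summable_scal, summable_theta; auto.
  - eapply has_sum_ext; [intros k; symmetry; apply alternating_eq|].
    apply has_sum_scal, theta_has_sum; auto.
Qed.

Lemma epi_IZR_odd (k : Z) : epi (IZR (- 2 * k - 1)) = - (1).
Proof. rewrite <- epi_0. apply (epi_neg _ _ (- k - 1)). cring. Qed.

Lemma epi_IZR_double (k : Z) : epi (IZR (2 * k)) = 1.
Proof. rewrite <- epi_0. apply (epi_eq _ _ k). cring. Qed.

(** The integer [d] is 0 for the supercharacters and 1 for the characters taken at z - 1/2; it
    enters the exponents through even integers only. The second index is written [s + 1] so that [s]
    is the power of y in the numerator. *)
Lemma Phi_arguments_1 (z : C) (d j : Z) :
  let y := epi (kpoint tau z (2 * j)) in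
  Cexp (2 * PI * Ci * (z + tau / 2)) * Cexp (2 * PI * Ci * IZR j * (2 * tau)) = y /\
  forall s : Z,
  Cexp (- (2 * PI * Ci * 2 * (tau / 8))) *
  (Cexp (2 * PI * Ci * 2 * IZR j * (z + tau / 2 + (z - tau / 2 + IZR d))
         + 2 * PI * Ci * IZR (s + 1) * (z + tau / 2))
   * Cexp (2 * PI * Ci * (2 * tau) * (2 * IZR j ^ 2 + IZR (s + 1) * IZR j)))
  = theta_term 1 0 (2 * tau) (2 * z) (2 * j) * epi (IZR s * kpoint tau z (2 * j)).
Proof.
  intros y. split.
  - unfold y, epi, kpoint. rewrite <- Cexp_plus. f_equal. cring.
  - intros s. unfold theta_term, kpoint. rewrite <- !Cexp_plus, <- epi_plus.
    rewrite <- (epi_eq (IZR (2 * (2 * j * d)) + (2 * tau * (IZR (2 * j) + INR 1 / 2) ^ 2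
      + 2 * (IZR (2 * j) + INR 1 / 2) * (2 * z + INR 0 / 2)
      + IZR s * (2 * z + (2 * IZR (2 * j) + 1) * tau))) _ (2 * j * d)) by (cast; ring).
    unfold epi. f_equal. simpl INR. cring.
Qed.

Lemma Phi_arguments_2 (z : C) (d j : Z) :
  let y := epi (kpoint tau z (- 2 * j - 1)) in
  Cexp (- (2 * PI * Ci * (z - tau / 2 + IZR d))) * Cexp (2 * PI * Ci * IZR j * (2 * tau)) = / y /\
  forall s : Z,
  Cexp (- (2 * PI * Ci * 2 * (tau / 8))) *
  (Cexp (- (2 * PI * Ci * 2 * IZR j * (z + tau / 2 + (z - tau / 2 + IZR d)))
         - 2 * PI * Ci * IZR (s + 1) * (z - tau / 2 + IZR d))
   * Cexp (2 * PI * Ci * (2 * tau) * (2 * IZR j ^ 2 + IZR (s + 1) * IZR j)))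
  = theta_term 1 0 (2 * tau) (2 * z) (- 2 * j - 1)
    * epi (- (IZR s * kpoint tau z (- 2 * j - 1))).
Proof.
  intros y. split.
  - unfold y, kpoint. rewrite <- epi_opp, <- Cexp_plus.
    rewrite <- (epi_eq (IZR (2 * - d) + - (2 * z + (2 * IZR (- 2 * j - 1) + 1) * tau)) _ (- d))
      by (cast; ring).
    unfold epi. f_equal. cring.
  - intros s. unfold theta_term, kpoint. rewrite <- !Cexp_plus, <- epi_plus.
    rewrite <- (epi_eq (IZR (2 * (- 2 * j * d - (s + 1) * d)) +
      (2 * tau * (IZR (- 2 * j - 1) + INR 1 / 2) ^ 2
      + 2 * (IZR (- 2 * j - 1) + INR 1 / 2) * (2 * z + INR 0 / 2)
      + - (IZR s * (2 * z + (2 * IZR (- 2 * j - 1) + 1) * tau)))) _ (- 2 * j * d - (s + 1) * d))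
      by (cast; ring).
    unfold epi. f_equal. simpl INR. cring.
Qed.

Lemma one_minus_neq_0 (y : C) : y <> 1 -> 1 - y <> 0.
Proof. intros H E. apply H. replace y with (1 - (1 - y)) by ring. rewrite E. ring. Qed.

(** Half of (1 + y) / (1 - y) + 1 is 1 / (1 - y), the even terms; half of (1 + y) / (1 - y) - 1 is y
    / (1 - y) = - 1 / (1 - 1 / y), the odd ones. *)
Lemma Phi_2_1 (z : C) (d : Z) : theta 0 1 tau z <> 0 ->
  Phi 2 1 (2 * tau) (z + tau / 2) (z - tau / 2 + IZR d) (tau / 8) =
  / 2 * (- Ci * theta 1 1 tau z * theta 1 0 tau z * theta 0 0 tau z / theta 0 1 tau z
         + - Ci * theta 1 1 (2 * tau) (2 * z)).
Proof.
  intros H0. destruct (lambert_has_sum tau Ht z H0) as [Sl Hl].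
  destruct (alternating_has_sum z) as [Sa Ha].
  apply (Phi_has_sum _ _ _ _ _ _ (fun k => / 2 * (lambert tau z k + alternating z k))).
  - apply summable_scal, summable_plus; auto.
  - apply has_sum_scal, has_sum_plus; auto.
  - intros j. destruct (Phi_arguments_1 z d j) as [E1 E2]. specialize (E2 0%Z).
    change (IZR (0 + 1)) with 1%R in E2. rewrite Cmult_div_assoc, E2, E1.
    rewrite Cmult_0_l, epi_0.
    unfold alternating, lambert. rewrite epi_IZR_double.
    pose proof (one_minus_neq_0 _ (epi_kpoint_neq_1 tau Ht z (2 * j) H0)). field. auto.
  - intros j. destruct (Phi_arguments_2 z d j) as [E1 E2]. specialize (E2 0%Z).
    change (IZR (0 + 1)) with 1%R in E2. rewrite Cmult_div_assoc, E2, E1.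
    replace (- (IZR 0 * kpoint tau z (- 2 * j - 1))) with (RtoC 0) by ring. rewrite epi_0.
    unfold alternating, lambert. rewrite epi_IZR_odd.
    pose proof (one_minus_neq_0 _ (epi_kpoint_neq_1 tau Ht z (- 2 * j - 1) H0)) as Hy.
    pose proof (epi_neq_0 (kpoint tau z (- 2 * j - 1))).
    set (y := epi (kpoint tau z (- 2 * j - 1))) in *.
    assert (y - 1 <> 0) by (intros E; apply Hy; replace (1 - y) with (- (y - 1)) by ring;
                            rewrite E; ring).
    field. auto.
Qed.

(** The opposite sign of D exchanges the two cases: y / (1 - y) for even k, and 1 / (1 - y) = - (1 /
    y) / (1 - 1 / y) for odd k. *)
Lemma Phi_2_2 (z : C) (d : Z) : theta 0 1 tau z <> 0 ->
  Phi 2 2 (2 * tau) (z + tau / 2) (z - tau / 2 + IZR d) (tau / 8) =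
  / 2 * (- Ci * theta 1 1 tau z * theta 1 0 tau z * theta 0 0 tau z / theta 0 1 tau z
         - - Ci * theta 1 1 (2 * tau) (2 * z)).
Proof.
  intros H0. destruct (lambert_has_sum tau Ht z H0) as [Sl Hl].
  destruct (alternating_has_sum z) as [Sa Ha].
  apply (Phi_has_sum _ _ _ _ _ _ (fun k => / 2 * (lambert tau z k - alternating z k))).
  - apply summable_scal, summable_minus; auto.
  - apply has_sum_scal, has_sum_minus; auto.
  - intros j. destruct (Phi_arguments_1 z d j) as [E1 E2]. specialize (E2 1%Z).
    change (IZR (1 + 1)) with 2%R in E2. rewrite Cmult_div_assoc, E2, E1.
    rewrite Cmult_1_l.
    unfold alternating, lambert. rewrite epi_IZR_double.
    pose proof (one_minus_neq_0 _ (epi_kpoint_neq_1 tau Ht z (2 * j) H0)). field. auto.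
  - intros j. destruct (Phi_arguments_2 z d j) as [E1 E2]. specialize (E2 1%Z).
    change (IZR (1 + 1)) with 2%R in E2. rewrite Cmult_div_assoc, E2, E1.
    rewrite Cmult_1_l, epi_opp.
    unfold alternating, lambert. rewrite epi_IZR_odd.
    pose proof (one_minus_neq_0 _ (epi_kpoint_neq_1 tau Ht z (- 2 * j - 1) H0)) as Hy.
    pose proof (epi_neq_0 (kpoint tau z (- 2 * j - 1))).
    set (y := epi (kpoint tau z (- 2 * j - 1))) in *.
    assert (y - 1 <> 0) by (intros E; apply Hy; replace (1 - y) with (- (y - 1)) by ring;
                            rewrite E; ring).
    field. auto.
Qed.

Lemma theta_a1_shift (a : nat) (z : C) : theta a 1 tau (z - 1 / 2) = theta a 0 tau z.
Proof.
  eapply theta_eq; [auto|apply theta_has_sum; auto|].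
  intros n. unfold theta_term. f_equal. simpl INR. field.
Qed.

Lemma theta_00_shift (z : C) : theta 0 0 tau (z - 1 / 2) = theta 0 1 tau z.
Proof.
  eapply theta_eq; [auto|apply theta_has_sum; auto|].
  intros n. unfold theta_term. apply (epi_eq _ _ (- n)). simpl INR. cring.
Qed.

Lemma theta_10_shift (z : C) : theta 1 0 tau (z - 1 / 2) = - theta 1 1 tau z.
Proof.
  eapply theta_eq; [auto|apply has_sum_opp, theta_has_sum; auto|].
  intros n. unfold theta_term. apply (epi_neg _ _ (- n - 1)). simpl INR. cring.
Qed.

Lemma theta_double_shift (a b : nat) (z : C) :
  theta a b (2 * tau) (2 * (z - 1 / 2)) = (-1) ^ a * theta a b (2 * tau) (2 * z).
Proof.
  eapply theta_eq; [auto|apply has_sum_scal, theta_has_sum; auto|].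
  intros n. unfold theta_term. rewrite <- epi_1.
  assert (E : forall k, epi 1 ^ k = epi (- INR k)).
  { intros k. rewrite epi_opp, epi_1. induction k as [|k IH].
    - simpl. rewrite epi_0. field.
    - rewrite S_INR, RtoC_plus, epi_add_1. simpl. rewrite IH.
      pose proof (epi_neq_0 (INR k)). field. auto. }
  rewrite E, <- epi_plus. apply (epi_eq _ _ (- n)). cring.
Qed.

End Characters.

(** The meromorphic identities are read pointwise off the zeros of theta11, theta00 and theta01,
    among which lie the poles of both sides. *)
Theorem proposition9p1 (tau z : C) (htau : (0 < Im tau)%R)
  (h11 : theta 1 1 tau z <> 0)
  (h00 : theta 0 0 tau z <> 0)
  (h01 : theta 0 1 tau z <> 0) :
  (ch_plus 4 1 tau z =
     Ci / 2 * (1 / (eta (tau / 2) * eta (2 * tau)))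
     * (theta 1 0 tau z / theta 0 1 tau z)
     * (eta (2 * tau) ^ 5 / (eta tau ^ 2 * eta (4 * tau) ^ 2)
          * theta 0 0 (2 * tau) (2 * z)
        - 2 * (eta (4 * tau) ^ 2 / eta (2 * tau)) * theta 1 0 (2 * tau) (2 * z)
        + theta 0 1 (2 * tau) (2 * z)))
  /\
  (ch_plus 4 3 tau z =
     Ci / 2 * (1 / (eta (tau / 2) * eta (2 * tau)))
     * (theta 1 0 tau z / theta 0 1 tau z)
     * (eta (2 * tau) ^ 5 / (eta tau ^ 2 * eta (4 * tau) ^ 2)
          * theta 0 0 (2 * tau) (2 * z)
        - 2 * (eta (4 * tau) ^ 2 / eta (2 * tau)) * theta 1 0 (2 * tau) (2 * z)
        - theta 0 1 (2 * tau) (2 * z)))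
  /\
  (ch_minus 4 1 tau z =
     - (Ci / 2) * (eta (tau / 2) / eta tau ^ 3)
     * (theta 1 0 tau z / theta 0 0 tau z)
     * (eta (2 * tau) ^ 5 / (eta tau ^ 2 * eta (4 * tau) ^ 2)
          * theta 0 0 (2 * tau) (2 * z)
        + 2 * (eta (4 * tau) ^ 2 / eta (2 * tau)) * theta 1 0 (2 * tau) (2 * z)
        + theta 0 1 (2 * tau) (2 * z)))
  /\
  (ch_minus 4 3 tau z =
     - (Ci / 2) * (eta (tau / 2) / eta tau ^ 3)
     * (theta 1 0 tau z / theta 0 0 tau z)
     * (eta (2 * tau) ^ 5 / (eta tau ^ 2 * eta (4 * tau) ^ 2)
          * theta 0 0 (2 * tau) (2 * z)
        + 2 * (eta (4 * tau) ^ 2 / eta (2 * tau)) * theta 1 0 (2 * tau) (2 * z)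
        - theta 0 1 (2 * tau) (2 * z))).
Proof.
  assert (htau2 : (0 < Im (2 * tau))%R) by (apply Im_double; auto).
  assert (hhalf : (0 < Im (tau / 2))%R).
  { replace (Im (tau / 2)) with (Im tau / 2)%R by (unfold Im; simpl; field). lra. }
  pose proof (eta_neq_0 _ htau) as He1. pose proof (eta_neq_0 _ htau2) as He2.
  pose proof (eta_neq_0 _ hhalf) as Heh.
  rewrite <- (theta00_double_0 tau htau), <- (theta10_double_0 tau htau).
  pose proof (theta00_theta01 tau htau z) as E01.
  pose proof (theta11_theta10 tau htau z) as E11.
  pose proof (theta00_sqr tau htau z) as Esq.
  (* Translation by 1/2 turns theta00 into theta01 and changes the sign of theta10 (2 tau, 2 z):
     these are the braces of the characters. *)
  pose proof (theta00_sqr tau htau (z - 1 / 2)) as Esq'.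
  rewrite !theta_double_shift, theta_00_shift in Esq' by auto.
  assert (Hc : theta 0 1 (2 * tau) 0 <> 0).
  { intros E. rewrite E, Cmult_0_l in E01. revert E01. apply Cmult_neq_0; auto. }
  assert (F01 : theta 0 1 (2 * tau) (2 * z) =
            theta 0 0 tau z * theta 0 1 tau z / theta 0 1 (2 * tau) 0)
    by (rewrite E01; field; auto).
  assert (F11 : theta 1 1 (2 * tau) (2 * z) =
            theta 1 1 tau z * theta 1 0 tau z / theta 0 1 (2 * tau) 0)
    by (rewrite E11; field; auto).
  assert (Bm : theta 0 0 (2 * tau) 0 * theta 0 0 (2 * tau) (2 * z)
            + theta 1 0 (2 * tau) 0 * theta 1 0 (2 * tau) (2 * z) = theta 0 0 tau z ^ 2)
    by (rewrite Esq; ring).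
  assert (Bp : theta 0 0 (2 * tau) 0 * theta 0 0 (2 * tau) (2 * z)
            - theta 1 0 (2 * tau) 0 * theta 1 0 (2 * tau) (2 * z) = theta 0 1 tau z ^ 2)
    by (rewrite Esq'; ring).
  unfold ch_plus, ch_minus, R_plus, R_minus.
  replace (INR 4 / 2)%R with 2%R by (simpl; field).
  replace ((INR 1 + 1) / 2)%R with 1%R by (simpl; field).
  replace ((INR 3 + 1) / 2)%R with 2%R by (simpl; field).
  replace (z + tau / 2 - 1 / 2) with ((z - 1 / 2) + tau / 2) by ring.
  (* Both arguments are now those of [Phi_2_1] and [Phi_2_2] at z - 1/2, with d = 1. *)
  replace (z - tau / 2 + 1 / 2) with ((z - 1 / 2) - tau / 2 + IZR 1) by field.
  replace (z - tau / 2) with (z - tau / 2 + IZR 0) by ring.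
  assert (h01' : theta 0 1 tau (z - 1 / 2) <> 0) by (rewrite theta_a1_shift; auto).
  rewrite !Phi_2_1, !Phi_2_2 by auto.
  rewrite !theta_double_shift, !theta_a1_shift, theta_00_shift, theta_10_shift by auto.
  (* The braces become theta01^2 or theta00^2, plus or minus theta00 theta01 / theta01 (2 tau,
     0). *)
  rewrite Bm, Bp, F01, F11.
  repeat split; field; repeat split; auto.
Qed.
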